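(* Let $k\ge1$ and suppose that $\mathbb E[X_i]=0$ and $\mathbb E[|X_i|^{k+1}]<\infty$ for every $i\in T$. Then for any $f\in\mathcal C^k(\mathbb R)$ for which the displayed expectations are finite, $$\mathbb E[Wf(W)]=\sum_{j=1}^k\frac{\kappa_{j+1}(W)}{j!}\,\mathbb E[\partial^jf(W)]+\sum_{H\in\mathcal G(k+2)}b_H\,\mathcal U_f(H)$$ and $$\mathbb E[Wf(W)]=\sum_{j=1}^{k-1}\frac{\kappa_{j+1}(W)}{j!}\,\mathbb E[\partial^jf(W)]+\frac{\widetilde\kappa_{k+1}}{k!}\,\mathbb E[\partial^kf(W)]+\sum_{H\in\mathcal P_0(k+2)\sqcup\mathcal P_1(k+2)\sqcup\mathcal G_0(k+1)}b_H\,\mathcal U_f(H),$$ where, for the fixed neighborhood radius $m$, $$\widetilde\kappa_{k+1}:=\kappa_{k+1}(W)+\sum_{H\in\mathcal G_0(k+1)}\frac{k!\,b_H}{k+2-u(k+1,H)}\,\mathcal S(H),$$ $$b_H:=\begin{cases}(-1)^{\gamma_H+\tau_H}&\text{if }|H|=2,\\(-1)^{\gamma_H+\tau_H}\prod_{j=2}^{|H|-1}\frac1{j+1-u(j,H)}&\text{if }|H|\ge3,\end{cases}$$ with $\gamma_H$ the number of leaves of $H$ and $\tau_H$ the number of vertices of $H$ with identifier $-1$.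
   Context: Probabilistic data. $T\subset\mathbb Z^d$ is finite and nonempty, $(X_i)_{i\in T}$ are real random variables with $\sigma^2:=\operatorname{Var}(\sum_{i\in T}X_i)>0$, $W:=\sigma^{-1}\sum_{i\in T}X_i$, and $W(J):=\sigma^{-1}\sum_{i\in T\setminus J}X_i$ for $J\subseteq T$. $\kappa_j(W)$ is the $j$-th cumulant. Fix a positive integer $m$ and a strict total order $\prec$ on $\mathbb Z^d$; $\|\cdot\|$ is the maximum norm. $\partial$ is differentiation. Genograms. An order-$k$ genogram $G=(V,E,(s_v)_{v\in V})$ is a rooted tree $(V,E)$ with $|G|:=|V|=k$ vertices and integer identifiers $s_v$ such that: (i) $s_v=0$ for the root and $s_v\ge-1$ for every other vertex; (ii) $s_v\ge0$ if $v$ is a child of the root; (iii) if a vertex has more than one child, the identifiers of its children are nonnegative and mutually different. Each genogram carries its unique compatible labeling $V=\{v[1],\dots,v[k]\}$: $v[1]$ is the root; for $1\le j\le k-1$, $v[j+1]$ is a child of the vertex with the largest label $\ell\le j$ having an as-yet unlabeled child; among siblings, a larger identifier gets a smaller label. Write $s_j$ for the identifier of $v[j]$. Two genograms are identified if their labeled trees and identifiers coincide; $\mathcal G(k)$ is the set of order-$k$ genograms. $\mathcal P_0(k):=\{G\in\mathcal G(k):s_j\le0\text{ for all }1\le j\le k\}$, $\mathcal G_0(k):=\mathcal G(k)\setminus\mathcal P_0(k)$, $\mathcal P_1(k):=\{G\in\mathcal G(k):s_j\le0\text{ for }1\le j\le k-1,\ s_k\ge1\}$. For $2\le j\le k$,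 $p(j)=p(j,G)$ is the label of the parent of $v[j]$; $A(j)=A(j,G)$ is the set of labels of the ancestors of $v[j]$ (excluding $j$; $A(1)=\varnothing$). Put $g(j)=g(j,G):=\sup\{\ell:\ell=1\text{ or }(\ell\in A(j)\text{ and }s_\ell\ge1)\}$ and $u(j)=u(j,G):=\sup\{\ell\in\{j\}\cup A(j):s_\ell\ge0\}$. $G[j]$ is the order-$j$ genogram induced on $v[1],\dots,v[j]$ with identifiers $s_1,\dots,s_j$. A leaf is a vertex with no children. Constraint sets. For nonempty $J\subseteq T$ let $d(i,J):=\min_{j\in J}\|i-j\|$, $N(J):=\{i\in T:d(i,J)\le m\}$. Order the elements of $T\setminus N(J)$ increasingly first by $d(i,J)$ and then, for equal distance, by $\prec$; $\operatorname{rk}(i,J)\in\{1,\dots,|T\setminus N(J)|\}$ is the position of $i$ in this ordering. For $s\ge0$, $N^{(s)}(J):=N(J)\cup\{i\in T\setminus N(J):\operatorname{rk}(i,J)\le s\}$. Given $G$, put $B_1:=T$, $D_1:=\varnothing$, and recursively, for $2\le j\le k$ and given $i_1\in B_1\setminus D_1,\dots,i_{j-1}\in B_{j-1}\setminus D_{j-1}$, $B_j:=N^{(s_j)}(\{i_\ell:\ell\in A(j)\})\cup D_{g(j)}$ if $s_j\ge0$, and $B_j:=B_{u(j)}$ if $s_j=-1$; $D_j:=N^{(s_j-1)}(\{i_\ell:\ell\in A(j)\})\cup D_{g(j)}$ if $s_j\ge1$, and $D_j:=D_{g(j)}$ if $s_j\le0$. Operators. For random variables, $\mathcal D^*(Y):=\mathbb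 E[Y]$, $\mathcal D(Y):=Y-\mathbb E[Y]$, and for $t\ge2$, $\mathcal D^*(Y_1,\dots,Y_t):=\mathbb E[Y_1\mathcal D(Y_2,\dots,Y_t)]$, $\mathcal D(Y_1,\dots,Y_t):=Y_1\mathcal D(Y_2,\dots,Y_t)-\mathbb E[Y_1\mathcal D(Y_2,\dots,Y_t)]$. For an order-$k$ genogram $G$, define $\mathcal E_G(Y_1,\dots,Y_k)$ recursively: if $k=1$, $\mathcal E_G(Y):=\mathbb E[Y]$. In general let $q_0:=\sup\{j:j=1\text{ or }(2\le j\le k\text{ and }p(j)\ne j-1)\}$ and let $q_1<\dots<q_w$ be the elements of $\{t:q_0+1\le t\le k,\ s_t\ge0\}$ (possibly $w=0$). Let $\mathcal D^*_{\mathrm{last}}:=\mathcal D^*(Y_{q_0}\cdots Y_{q_1-1},\,Y_{q_1}\cdots Y_{q_2-1},\,\dots,\,Y_{q_w}\cdots Y_k)$, read as $\mathcal D^*(Y_{q_0}\cdots Y_k)$ when $w=0$. Then $\mathcal E_G(Y_1,\dots,Y_k):=\mathcal D^*_{\mathrm{last}}$ if $q_0=1$, and $:=\mathcal E_{G[q_0-1]}(Y_1,\dots,Y_{q_0-1})\cdot\mathcal D^*_{\mathrm{last}}$ if $q_0\ge2$. Sums. For $G\in\mathcal G(k)$, $\mathcal S(G):=\sigma^{-k}\sum_{i_1\in B_1\setminus D_1}\cdots\sum_{i_k\in B_k\setminus D_k}\mathcal E_G(X_{i_1},\dots,X_{i_k})$; and for $k\ge2$ and $f\in\mathcal C^{k-2}(\mathbb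 R)$, $\mathcal U_f(G):=\sigma^{-(k-1)}\sum_{i_1\in B_1\setminus D_1}\cdots\sum_{i_{k-1}\in B_{k-1}\setminus D_{k-1}}\mathcal E_G(X_{i_1},\dots,X_{i_{k-1}},\Delta_f(G))$, where $\Delta_f(G):=\partial^{k-2}f(W(B_k))-\partial^{k-2}f(W(D_k))$ if $u(k)=k$, and $\Delta_f(G):=\int_0^1(k-u(k))v^{k-1-u(k)}\bigl(\partial^{k-2}f(vW(D_k)+(1-v)W(B_k))-\partial^{k-2}f(W(D_k))\bigr)\,dv$ if $u(k)\le k-1$. Since $T$ is finite, only finitely many terms in the sums over genograms are nonzero. *)

(* Defs.v *)
From HB Require Import structures.
From mathcomp Require Import all_boot all_order all_algebra finmap.
From mathcomp Require Import all_classical all_reals all_analysis.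

Set Implicit Arguments.
Unset Strict Implicit.
Unset Printing Implicit Defensive.
Import Order.TTheory GRing.Theory Num.Theory numFieldNormedType.Exports.

Local Open Scope classical_set_scope.
Local Open Scope fset_scope.
Local Open Scope ring_scope.

(** Genograms are identified when their compatibly labeled trees and identifiers
  coincide, so an order-[k] genogram is represented by its labeled tree: the
  list of pairs (label of the parent of v[j], identifier of v[j]) for
  j = 1, ..., k.  Labels are 1-based as on paper; the root v[1] carries the
  dummy parent label 0. *)

Definition genogram : Type := seq (nat * int).

Definition entry (G : genogram) (j : nat) : nat * int :=
  nth (0%N, 0) ((0%N, 0) :: G) j.

Definition parent (G : genogram) (j : nat) : nat := (entry G j).1.
Definition ident (G : genogram) (j : nat) : int := (entry G j).2.

Record is_genogram (G : genogram) : Prop := IsGenogram {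
  genogram_nonempty : (1 <= size G)%N;
  genogram_root : parent G 1 = 0%N /\ ident G 1 = 0;
  (* A parent map with p(j) < j is a tree rooted at 1; p(j) < j is also forced
     by the labeling rule, v[j] being a child of an already labeled vertex. *)
  genogram_tree : forall j, (2 <= j <= size G)%N -> (1 <= parent G j < j)%N;
  genogram_ident : forall j, (2 <= j <= size G)%N -> -1 <= ident G j;
  genogram_ident_root_child : forall j, (2 <= j <= size G)%N ->
    parent G j = 1%N -> 0 <= ident G j;
  genogram_ident_siblings : forall i j, (2 <= i <= size G)%N ->
    (2 <= j <= size G)%N -> i <> j -> parent G i = parent G j ->
    0 <= ident G i /\ ident G i <> ident G j;
  (* v[j+1] is a child of the vertex with the largest label l <= j that still
     has an unlabeled child, i.e. a child with label > j. *)
  genogram_labeling : forall j l i, (1 <= j < size G)%N ->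
    (parent G j.+1 < l <= j)%N -> (j < i <= size G)%N -> parent G i <> l;
  genogram_labeling_siblings : forall i j, (2 <= i <= size G)%N ->
    (2 <= j <= size G)%N -> parent G i = parent G j ->
    ident G j < ident G i -> (i < j)%N
}.

Definition genograms (k : nat) : set genogram :=
  [set G | is_genogram G /\ size G = k].

Definition P0 (k : nat) : set genogram :=
  [set G | genograms k G /\ forall j, (1 <= j <= k)%N -> ident G j <= 0].

Definition G0 (k : nat) : set genogram := genograms k `\` P0 k.

Definition P1 (k : nat) : set genogram :=
  [set G | genograms k G /\
    (forall j, (1 <= j <= k.-1)%N -> ident G j <= 0) /\ 1 <= ident G k].

(* p(j), p(p(j)), ...; the dummy label 0 and what follows it are dropped.
   As p(j) < j, [j] iterations reach the root. *)
Definition ancestors (G : genogram) (j : nat) : seq nat :=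
  [seq l <- traject (parent G) (parent G j) j | (1 <= l)%N].

Definition gidx (G : genogram) (j : nat) : nat :=
  (\max_(l <- 1%N :: [seq l <- ancestors G j | (1 <= ident G l)%R]) l)%N.

Definition uidx (G : genogram) (j : nat) : nat :=
  (\max_(l <- [seq l <- j :: ancestors G j | (0 <= ident G l)%R]) l)%N.

Definition leaves (G : genogram) : seq nat :=
  [seq j <- iota 1 (size G) | all (fun i => parent G i != j) (iota 1 (size G))].

Definition gamma (G : genogram) : nat := size (leaves G).

Definition tau (G : genogram) : nat :=
  count (fun j => ident G j == -1) (iota 1 (size G)).

(* For |G| = 2 the product is empty. *)
Definition bcoef (R : realType) (G : genogram) : R :=
  (-1) ^+ (gamma G + tau G) *
  \prod_(2 <= j < size G) ((j.+1 - uidx G j)%N%:R)^-1.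

Section Constraint.
Variables (d m : nat) (prec : rel 'rV[int]_d) (T : {fset 'rV[int]_d}).
Implicit Types (i : 'rV[int]_d) (J : {fset 'rV[int]_d}).

Definition maxnorm i : nat := (\max_(c < d) `|i ord0 c|)%N.

(* min_{j in J} ||i - j|| for nonempty J: [minn] has no neutral element, so the
   minimum starts from the value at one element of J. *)
Definition distJ i J : nat :=
  \big[minn/maxnorm (i - head i J)]_(j <- J) maxnorm (i - j).

Definition nbhd J : {fset 'rV[int]_d} := [fset i in T | (distJ i J <= m)%N].

Definition before J i i' : bool :=
  (distJ i J < distJ i' J)%N || ((distJ i J == distJ i' J) && prec i i').

Definition rk i J : nat := #|` [fset x in T `\` nbhd J | before J x i] |.+1.

Definition nbhds (s : nat) J : {fset 'rV[int]_d} :=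
  nbhd J `|` [fset i in T `\` nbhd J | (rk i J <= s)%N].

Variable G : genogram.

(* [ii] lists i_1, i_2, ..., so i_l is [nth 0 ii l.-1]. *)
Definition ancestor_points (ii : seq 'rV[int]_d) (j : nat) :
    {fset 'rV[int]_d} :=
  [fset nth 0 ii l.-1 | l in ancestors G j].

(* Since g(j) < j and u(j) < j in the recursive calls, fuel [j] suffices. *)
Fixpoint Dset_rec (ii : seq 'rV[int]_d) (n j : nat) : {fset 'rV[int]_d} :=
  if n is n'.+1 then
    if (j <= 1)%N then fset0
    else if 1 <= ident G j
    then nbhds (`|ident G j|%N).-1 (ancestor_points ii j)
           `|` Dset_rec ii n' (gidx G j)
    else Dset_rec ii n' (gidx G j)
  else fset0.

Definition Dset (ii : seq 'rV[int]_d) (j : nat) := Dset_rec ii j j.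

Fixpoint Bset_rec (ii : seq 'rV[int]_d) (n j : nat) : {fset 'rV[int]_d} :=
  if n is n'.+1 then
    if (j <= 1)%N then T
    else if 0 <= ident G j
    then nbhds `|ident G j|%N (ancestor_points ii j) `|` Dset ii (gidx G j)
    else Bset_rec ii n' (uidx G j)
  else fset0.

Definition Bset (ii : seq 'rV[int]_d) (j : nat) := Bset_rec ii j j.

(* All (i_1, ..., i_n) with i_j in B_j \ D_j, where B_j and D_j depend on
   (i_1, ..., i_{j-1}): the index set of the iterated sum. *)
Fixpoint indices (n : nat) : seq (seq 'rV[int]_d) :=
  if n is n'.+1 then
    [seq rcons ii i | ii <- indices n', i <- Bset ii n `\` Dset ii n]
  else [:: [::]].

End Constraint.

Section Operators.
Context {disp : measure_display} {Omega : measurableType disp} {R : realType}.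
Variable P : probability Omega R.
Implicit Type Y : seq (Omega -> R).

Definition Ex (Y : Omega -> R) : R := fine 'E_P[Y].

Definition finite_Ex (Y : Omega -> R) : Prop :=
  P.-integrable setT (EFin \o Y).

Fixpoint Dop Y : Omega -> R :=
  match Y with
  | [::] => fun=> 0
  | [:: Y1] => fun w => Y1 w - Ex Y1
  | Y1 :: Y' => fun w => Y1 w * Dop Y' w - Ex (fun w' => Y1 w' * Dop Y' w')
  end.

Definition Dstar Y : R :=
  match Y with
  | [::] => 0
  | [:: Y1] => Ex Y1
  | Y1 :: Y' => Ex (fun w => Y1 w * Dop Y' w)
  end.

(* All expectations occurring in [Dstar Y] are finite. *)
Fixpoint finite_Dstar Y : Prop :=
  match Y with
  | [::] => True
  | [:: Y1] => finite_Ex Y1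
  | Y1 :: Y' => finite_Ex (fun w => Y1 w * Dop Y' w) /\ finite_Dstar Y'
  end.

Definition qzero (G : genogram) : nat :=
  (\max_(j <- 1 :: [seq j <- iota 2 (size G).-1 | parent G j != j.-1]) j)%N.

Definition qseq (G : genogram) : seq nat :=
  qzero G :: [seq t <- iota (qzero G).+1 (size G - qzero G)
             | (0 <= ident G t)%R].

(* The arguments Y_{q_r} ... Y_{q_{r+1} - 1} of D*_last, with q_{w+1} = k + 1. *)
Definition last_blocks (G : genogram) Y : seq (Omega -> R) :=
  [seq (fun w => \prod_(q.1 <= t < q.2) nth (fun=> 0) Y t.-1 w)
  | q <- zip (qseq G) (rcons (behead (qseq G)) (size G).+1)].

(* [take j G] is the genogram G[j]; fuel |G| suffices. *)
Fixpoint EG_rec (n : nat) (G : genogram) Y : R :=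
  if n is n'.+1 then
    if qzero G == 1%N then Dstar (last_blocks G Y)
    else EG_rec n' (take (qzero G).-1 G) (take (qzero G).-1 Y)
           * Dstar (last_blocks G Y)
  else 0.

Definition EG (G : genogram) Y : R := EG_rec (size G) G Y.

Definition moment (n : nat) (Z : Omega -> R) : R := Ex (fun w => Z w ^+ n).

(* sum_{i = 1}^n E[Z^i] t^i / i!, the moment generating series of Z minus 1,
   up to order n. *)
Definition mgf_trunc (n : nat) (Z : Omega -> R) : {poly R} :=
  \poly_(i < n.+1) (if i == 0%N then 0 else moment i Z / i`!%:R).

(* The n-th cumulant is n! times the coefficient of t^n in the formal series
   log (1 + M) = sum_{r >= 1} (-1)^(r-1) M^r / r, where 1 + M is the moment
   generating series of Z.  Only moments of order at most n and powers r <= n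
   contribute, since M has no constant term. *)
Definition cumulant (n : nat) (Z : Omega -> R) : R :=
  n`!%:R *
  \sum_(1 <= r < n.+1) (-1) ^+ r.-1 / r%:R * (mgf_trunc n Z ^+ r)`_n.

End Operators.

Definition Ck {R : realType} (n : nat) (f : R -> R) : Prop :=
  (forall j x, (j < n)%N -> derivable (derive1n j f) x 1) /\ continuous (derive1n n f).

Section Sums.
Context {disp : measure_display} {Omega : measurableType disp} {R : realType}.
Variables (P : probability Omega R) (d m : nat) (prec : rel 'rV[int]_d).
Variables (T : {fset 'rV[int]_d}) (X : 'rV[int]_d -> {RV P >-> R}).

Definition sumX (w : Omega) : R := \sum_(i <- T) X i w.

Definition sigma : R := Num.sqrt (fine 'V_P[sumX]).

Definition W (w : Omega) : R := sigma^-1 * sumX w.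

Definition Wminus (J : {fset 'rV[int]_d}) (w : Omega) : R :=
  sigma^-1 * \sum_(i <- T `\` J) X i w.

Definition Ssum (G : genogram) : R :=
  sigma ^- size G *
  \sum_(ii <- indices m prec T G (size G))
    EG P G [seq (X i : Omega -> R) | i <- ii].

Definition Delta (f : R -> R) (G : genogram) (ii : seq 'rV[int]_d)
    (w : Omega) : R :=
  let k := size G in
  let u := uidx G k in
  let h := derive1n (k - 2) f in
  let WB := Wminus (Bset m prec T G ii k) w in
  let WD := Wminus (Dset m prec T G ii k) w in
  if u == k then h WB - h WD
  else \int[lebesgue_measure]_(v in `[0, 1])
         ((k - u)%N%:R * v ^+ (k.-1 - u) * (h (v * WD + (1 - v) * WB) - h WD)).

Definition Uargs (f : R -> R) (G : genogram) (ii : seq 'rV[int]_d) :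
    seq (Omega -> R) :=
  rcons [seq (X i : Omega -> R) | i <- ii] (Delta f G ii).

Definition Usum (f : R -> R) (G : genogram) : R :=
  sigma ^- (size G).-1 *
  \sum_(ii <- indices m prec T G (size G).-1) EG P G (Uargs f G ii).

(* All expectations occurring in U_f(G) are finite.  Only the last factor
   D*_last of E_G involves Delta_f(G); the other factors, like those of S(G),
   are expectations of products of the X_i. *)
Definition finite_Usum (f : R -> R) (G : genogram) : Prop :=
  forall ii, ii \in indices m prec T G (size G).-1 ->
  finite_Dstar P (last_blocks G (Uargs f G ii)).

(* [G0 k.+1] is infinite, but only finitely many terms are nonzero: T being
   finite, B_j = D_j as soon as s_j > |T|. *)
Definition kappa_tilde (k : nat) : R :=
  cumulant P k.+1 W +
  \sum_(H \in G0 k.+1)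
    (k`!%:R * bcoef R H / (k.+2 - uidx H k.+1)%N%:R * Ssum H).

End Sums.

(* Main.v *)
Require Import Defs.
From mathcomp Require Import all_boot all_order all_algebra finmap.
From mathcomp Require Import all_classical all_reals all_analysis.
From mathcomp Require Import measurable_realfun zify ring lra.
Import Order.TTheory GRing.Theory Num.Theory numFieldNormedType.Exports.

(** Integrating by parts, [Delta_f(H)] for a genogram [H] of order [K] becomes
  [- (K + 1 - u(K))^-1 sigma^-1 sum_{i in B_K \ D_K} X_i (h(W(D_K)) + Delta_f(H'))]
  with [h] the [(K - 1)]-st derivative of [f] and [H'] the extension of [H] by a
  child of [v[K]] with identifier [-1].  Adding instead a child of [v[K]] with
  identifier [0, 1, 2, ...], the increments of [h] telescope to
  [h(0) - h(W(D_K))]; adding a younger sibling to the vertices on the path from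
  the root to [v[K]], they telescope to [h(W(D_K)) - h(W)].  Together these are
  all the extensions of [H] by one vertex, and [b] absorbs signs and factors, so
  [sum_{G(K)} b U_f = c_K E h(W) + sum_{G(K+1)} b U_f], where [c_K] depends only
  on the sums [S(H)].  The steps [K = 1, ..., k + 1] give the first expansion,
  and leaving the genograms of [G_0(k + 1)] unexpanded gives the second.  That
  [c_K = kappa_K / (K - 1)!] follows by taking [f] to be a monomial, for which
  the remainder vanishes and the expansion is the moment-cumulant recursion. *)

Set Implicit Arguments.
Unset Strict Implicit.
Unset Printing Implicit Defensive.

Local Open Scope classical_set_scope.
Local Open Scope fset_scope.
Local Open Scope ring_scope.

(** * Genograms as iterated one-vertex extensions *)

Section Labels.
Implicit Types (G H : genogram) (e : nat * int).

(** Children and siblings arise from an identity for expectations. Let y be the last argument of the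
    last factor [Dstar] and z = h(W(D_K)). Since y z = y (z - E z) + (E z) y, [Dstar] with last
    argument y z is the sum of a term in which z is an argument of its own and a term in which E z
    splits off as a factor. In the first term z gets centered, so the constant h(0) drops out and
    only the increments over children of v[K] survive. In the second, z stands in a new factor,
    exactly as a vertex that is not a child of its predecessor; there the increments over siblings
    appear and E h(W) is left over. Identifiers are unbounded, but the neighborhood of rank |T| is
    all of T, so a genogram with an identifier above |T| contributes nothing. Finite lists of
    genograms can therefore replace the infinite sets. The sums U_f of intermediate order are not
    assumed to have finite expectations. Hence each expansion step also derives finiteness for a
    genogram from that of its extensions, while mixed products of the X_i are controlled by their
    moments of order k + 1. *)

Definition treelike G := forall j, (0 < j)%N -> (parent G j < j)%N.

Lemma parent_default G j : (size G < j)%N -> parent G j = 0%N.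
Proof. by move=> h; rewrite /parent /entry nth_default. Qed.

(** Past the end of the list the default parent is 0, as for the root. The inequality thus holds at
    every positive label, and recursions along parents need no range condition. *)
Lemma genogram_treelike G : is_genogram G -> treelike G.
Proof.
move=> gG j j0; case: (leqP j (size G)) => [jG|/parent_default -> //].
have [j1|j1] := leqP j 1; last first.
  by have := genogram_tree gG (j := j) ltac:(lia); lia.
have -> : j = 1%N by lia.
by case: (genogram_root gG) => ->.
Qed.

Lemma entry_rcons G e j : (j <= size G)%N -> entry (rcons G e) j = entry G j.
Proof. by case: j => // j jG; rewrite /entry /= nth_rcons jG. Qed.

Lemma entry_rcons_last G e : entry (rcons G e) (size G).+1 = e.
Proof. by rewrite /entry /= nth_rcons ltnn eqxx. Qed.

Lemma parent_rcons G e j : (j <= size G)%N -> parent (rcons G e) j = parent G j.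
Proof. by move=> h; rewrite /parent entry_rcons. Qed.

Lemma ident_rcons G e j : (j <= size G)%N -> ident (rcons G e) j = ident G j.
Proof. by move=> h; rewrite /ident entry_rcons. Qed.

Lemma parent_rcons_last G e : parent (rcons G e) (size G).+1 = e.1.
Proof. by rewrite /parent entry_rcons_last. Qed.

Lemma ident_rcons_last G e : ident (rcons G e) (size G).+1 = e.2.
Proof. by rewrite /ident entry_rcons_last. Qed.

Lemma treelike_rcons G e :
  treelike G -> (e.1 <= size G)%N -> treelike (rcons G e).
Proof.
move=> tG pe j j0; have [jG|] := leqP j (size G).
  by rewrite parent_rcons //; exact: tG.
rewrite leq_eqVlt => /predU1P[<-|jG]; first by rewrite parent_rcons_last.
by rewrite parent_default // size_rcons.
Qed.

(* The fuel in [ancestors] is irrelevant as soon as it reaches the dummy label. *)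
Lemma traject_parent_fuel G n x : treelike G -> (x <= n)%N ->
  [seq l <- traject (parent G) x n | (1 <= l)%N] =
  [seq l <- traject (parent G) x x | (1 <= l)%N].
Proof.
move=> tG; elim/ltn_ind: n x => n IH [|x] xn.
  by elim: n {IH xn} => //= n ->.
case: n xn IH => // n xn IH /=; congr cons.
have px := tG x.+1 isT.
by rewrite (IH n) 1?(IH x) //; lia.
Qed.

Lemma ancestorsE G j : treelike G -> (0 < parent G j)%N ->
  ancestors G j = parent G j :: ancestors G (parent G j).
Proof.
move=> tG; rewrite /ancestors; case pj: (parent G j) => [//|p] _.
have j0 : (0 < j)%N by case: j pj.
have := tG j j0; rewrite pj => pj'.
rewrite traject_parent_fuel //; last by lia.
rewrite [LHS]/=; congr cons.
have tp := tG p.+1 isT.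
by rewrite (@traject_parent_fuel _ p) 1?(@traject_parent_fuel _ p.+1) //; lia.
Qed.

Lemma ancestors_nil G j : parent G j = 0%N -> ancestors G j = [::].
Proof.
by rewrite /ancestors => ->; elim: j => //= j ->.
Qed.

Lemma mem_ancestors G j l : treelike G -> l \in ancestors G j ->
  (0 < l < j)%N.
Proof.
move=> tG; elim/ltn_ind: j => j IH.
have [p0|p0] := posnP (parent G j); first by rewrite ancestors_nil.
have j0 : (0 < j)%N by case: j p0 {IH}.
have pj := tG j j0.
rewrite ancestorsE // inE => /predU1P[->|/(IH _ pj)]; lia.
Qed.

Lemma ancestors_rcons G e j : treelike G -> (0 < j <= size G)%N ->
  ancestors (rcons G e) j = ancestors G j.
Proof.
move=> tG; elim/ltn_ind: j => j IH /andP[j0 jG].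
rewrite /ancestors parent_rcons //.
have H : forall n x, (x <= size G)%N ->
    traject (parent (rcons G e)) x n = traject (parent G) x n.
  elim=> //= n IHn x xG; rewrite parent_rcons // IHn //.
  case: x xG => // x xG; have := tG x.+1 isT; lia.
by rewrite H //; exact: leq_trans (ltnW (tG _ j0)) jG.
Qed.

Lemma ancestors_rcons_last G e :
  treelike G -> (0 < e.1 <= size G)%N ->
  ancestors (rcons G e) (size G).+1 = e.1 :: ancestors G e.1.
Proof.
move=> tG /andP[e0 eG].
rewrite ancestorsE ?parent_rcons_last //; last exact: treelike_rcons.
by rewrite ancestors_rcons // e0.
Qed.

Definition lineage G j := j :: ancestors G j.

Lemma lineageE G j : treelike G -> (0 < parent G j)%N ->
  lineage G j = j :: lineage G (parent G j).
Proof. by move=> tG p0; rewrite /lineage ancestorsE. Qed.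

Lemma mem_lineage G j l : treelike G -> (0 < j)%N -> l \in lineage G j ->
  (0 < l <= j)%N.
Proof.
by move=> tG j0; rewrite inE => /predU1P[->|/(mem_ancestors tG)]; lia.
Qed.

(** The path from the root to v[j] climbs from label 1 to label j, so one of its edges steps over t.
    The labeling rule is applied to such edges. *)
Lemma lineage_crossing G j t : treelike G -> (0 < t <= j)%N ->
  exists2 c, c \in lineage G j & (parent G c < t <= c)%N.
Proof.
move=> tG; elim/ltn_ind: j => j IH tj.
have j0 : (0 < j)%N by lia.
have [pt|tp] := ltnP (parent G j) t.
  by exists j; [rewrite inE eqxx | lia].
have [c cL tc] := IH (parent G j) (tG j j0) ltac:(lia).
exists c => //; rewrite lineageE //; last lia.
by rewrite inE cL orbT.
Qed.

(** Only the part of the path between v[a] and v[j] is searched, so both ends of the crossing edge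
    have labels at least a. *)
Lemma lineage_crossing_above G j a t : treelike G -> (0 < j)%N ->
  a \in lineage G j -> (a < t <= j)%N ->
  exists2 c, c \in lineage G j & [&& a <= parent G c, parent G c < t & t <= c]%N.
Proof.
move=> tG; elim/ltn_ind: j => j IH j0.
have [p0|p0] := posnP (parent G j).
  by rewrite /lineage ancestors_nil // inE => /eqP ->; lia.
rewrite lineageE // inE => /predU1P[->|aL] tj; first lia.
have pj := tG j j0.
have := mem_lineage tG p0 aL.
have [pt|tp] := ltnP (parent G j) t => ap.
  by exists j; [rewrite inE eqxx | lia].
have [c cL tc] := IH (parent G j) pj p0 aL ltac:(lia).
by exists c => //; rewrite inE cL orbT.
Qed.

Lemma lineage_child G j l : treelike G -> l \in ancestors G j ->
  exists2 c, c \in lineage G j & parent G c = l.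
Proof.
move=> tG; elim/ltn_ind: j => j IH.
have [p0|p0] := posnP (parent G j); first by rewrite ancestors_nil.
have j0 : (0 < j)%N by case: j p0 {IH}.
rewrite ancestorsE // inE => /predU1P[->|lA].
  by exists j; rewrite ?inE ?eqxx.
have [c cL pc] := IH _ (tG j j0) lA.
by exists c => //; rewrite lineageE // inE cL orbT.
Qed.

Lemma bigmax_seq_head (j : nat) (s : seq nat) :
  (forall l, l \in s -> (l <= j)%N) -> (\max_(l <- j :: s) l = j)%N.
Proof.
move=> sj; rewrite big_cons; apply/maxn_idPl/bigmax_leqP_seq => l ls _.
exact: sj.
Qed.

Lemma uidx_nonneg G j : treelike G -> 0 <= ident G j -> uidx G j = j.
Proof.
move=> tG sj; rewrite /uidx /= sj bigmax_seq_head // => l.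
by rewrite mem_filter => /andP[_ /(mem_ancestors tG)]; lia.
Qed.

Lemma uidx_neg G j : treelike G -> (0 < parent G j)%N -> ident G j < 0 ->
  uidx G j = uidx G (parent G j).
Proof.
by move=> tG p0 sj; rewrite /uidx /= leNgt sj /= ancestorsE.
Qed.

Lemma gidxE G j : treelike G -> (0 < parent G j)%N ->
  gidx G j = if 1 <= ident G (parent G j) then parent G j
             else gidx G (parent G j).
Proof.
move=> tG p0; rewrite /gidx ancestorsE //=; case: ifP => // s1.
rewrite big_cons bigmax_seq_head; first exact/maxn_idPr.
by move=> l; rewrite mem_filter => /andP[_ /(mem_ancestors tG)]; lia.
Qed.

Lemma gidx_root G j : parent G j = 0%N -> gidx G j = 1%N.
Proof. by move=> p0; rewrite /gidx ancestors_nil // big_cons big_nil. Qed.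

Lemma gidx_lt G j : treelike G -> (1 < j)%N -> (gidx G j < j)%N.
Proof.
move=> tG j1; rewrite /gidx big_cons gtn_max j1 /=.
rewrite -ltnS in j1.
have : (\max_(l <- [seq l <- ancestors G j | (1 <= ident G l)%R]) l <= j.-1)%N.
  apply/bigmax_leqP_seq => l; rewrite mem_filter => /andP[_ /(mem_ancestors tG)].
  by move=> + _; lia.
lia.
Qed.

Lemma uidx_rcons G e j : treelike G -> (0 < j <= size G)%N ->
  uidx (rcons G e) j = uidx G j.
Proof.
move=> tG jG; rewrite /uidx ancestors_rcons //.
congr (\big[_/_]_(_ <- _) _); apply: eq_in_filter => l.
rewrite inE => lj; rewrite ident_rcons //.
by case/predU1P: lj => [->|/(mem_ancestors tG)]; lia.
Qed.

(* By the labeling rule a new vertex is a child of [v[K]] or of an ancestor of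
   [v[K]]; in the latter case its identifier is below that of its sibling on the
   path from the root to [v[K]]. *)
Definition side_ext G j : seq (nat * int) :=
  flatten [seq [seq (parent G c, s%:Z) | s <- iota 0 `|ident G c|%N]
          | c <- lineage G j & (1 <= ident G c)%R].

Lemma side_extE G j : treelike G -> (0 < parent G j)%N ->
  side_ext G j =
  (if 1 <= ident G j then [seq (parent G j, s%:Z) | s <- iota 0 `|ident G j|%N]
   else [::]) ++ side_ext G (parent G j).
Proof.
by move=> tG p0; rewrite /side_ext lineageE //=; case: ifP.
Qed.

Lemma mem_side_ext G j e : reflect
  (exists c, [/\ c \in lineage G j, 1 <= ident G c, e.1 = parent G c
                & 0 <= e.2 < ident G c])
  (e \in side_ext G j).
Proof.
apply: (iffP flatten_mapP) => [[c]|[c [cL c1 e1 e2]]].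
  rewrite mem_filter => /andP[c1 cL] /mapP[s]; rewrite mem_iota => sc ->.
  by exists c; split=> //=; lia.
exists c; first by rewrite mem_filter c1.
apply/mapP; exists `|e.2|%N; first by rewrite mem_iota; lia.
by rewrite [LHS]surjective_pairing e1; congr pair; lia.
Qed.

Lemma side_ext_uniq G j : treelike G -> uniq (side_ext G j).
Proof.
move=> tG; elim/ltn_ind: j => j IH.
have U p n : uniq [seq (p, s%:Z) | s <- iota 0 n] :> bool.
  by rewrite map_inj_uniq ?iota_uniq // => x y [].
have [p0|p0] := posnP (parent G j).
  rewrite /side_ext /lineage ancestors_nil //=; case: ifP => //= _.
  by rewrite cats0.
have j0 : (0 < j)%N by case: j p0 {IH}.
rewrite side_extE // cat_uniq IH ?tG // andbT; apply/andP; split.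
  by case: ifP.
apply/hasPn => e /mem_side_ext[c [/(mem_lineage tG p0) cj _ e1 _]].
have := tG c ltac:(lia); rewrite -e1 => ec.
case: ifP => // _; apply/negP => /mapP[s _ es].
by move: ec; rewrite es /=; lia.
Qed.

(** The bound [S] is imposed only on children of the last vertex; a side vertex is already bounded
    by its sibling on the path. Identifier -1 is withheld from children of the root. *)
Definition ext (S : nat) G : seq (nat * int) :=
  [seq (size G, s%:Z) | s <- iota 0 S.+1] ++
  (if (1 < size G)%N then [:: (size G, - 1)] else [::]) ++
  side_ext G (size G).

Lemma mem_ext S G e : (e \in ext S G) =
  [|| (e.1 == size G) && (0 <= e.2 <= S%:Z),
      [&& e.1 == size G, (e.2 == - 1) & (1 < size G)%N]
    | e \in side_ext G (size G)].
Proof.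
rewrite !mem_cat; congr [|| _, _ | _].
  apply/mapP/andP => [[s + ->]|[/eqP e1 e2]]; first by rewrite mem_iota /=; lia.
  exists `|e.2|%N; first by rewrite mem_iota; lia.
  by rewrite [LHS]surjective_pairing e1; congr pair; lia.
case: ifP; rewrite ?inE ?andbF // andbT => _.
by case: e => a b; rewrite xpair_eqE.
Qed.

Lemma ext_uniq S G : treelike G -> (0 < size G)%N -> uniq (ext S G).
Proof.
move=> tG G0; rewrite /ext cat_uniq map_inj_uniq; last by move=> x y [].
rewrite iota_uniq andTb cat_uniq side_ext_uniq // andbT.
have L e : e \in side_ext G (size G) -> (e.1 < size G)%N.
  move=> /mem_side_ext[c [/(mem_lineage tG G0) cj _ -> _]].
  by have := tG c ltac:(lia); lia.
have -> : uniq (if (1 < size G)%N then [:: (size G, (-1)%R : int)] else [::]).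
  by case: ifP.
rewrite andTb; apply/andP; split; apply/hasPn => e.
  rewrite mem_cat => /orP[|/L e1]; last first.
    by apply/mapP => -[s _ es]; rewrite es /= ltnn in e1.
  case: ifP => // _; rewrite mem_seq1 => /eqP ->.
  by apply/mapP => -[s _ []].
move=> /L e1; case: ifP => // _; rewrite mem_seq1; apply/negP => /eqP es.
by rewrite es /= ltnn in e1.
Qed.

(** * One-vertex extensions and the genograms of the next order *)

Lemma genogram_prefix G e : (0 < size G)%N ->
  is_genogram (rcons G e) -> is_genogram G.
Proof.
move=> G0 [_ [r1 r2] tr id rc sib lab labs]; rewrite size_rcons in tr id rc sib
  lab labs.
split=> //.
- by rewrite parent_rcons // in r1; rewrite ident_rcons // in r2.
- move=> j jG; rewrite -(parent_rcons e) ?tr //; lia.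
- move=> j jG; rewrite -(ident_rcons e) ?id //; lia.
- move=> j jG; have jG' : (j <= size G)%N by lia.
  by rewrite -(parent_rcons e jG') -(ident_rcons e jG') => ?; apply: rc => //; lia.
- move=> i j iG jG.
  have [iG' jG'] : (i <= size G)%N /\ (j <= size G)%N by lia.
  rewrite -(parent_rcons e iG') -(parent_rcons e jG') -(ident_rcons e iG')
    -(ident_rcons e jG') => ij pij.
  by apply: sib => //; lia.
- move=> j l i jG lj ij.
  have [iG' jG'] : (i <= size G)%N /\ (j.+1 <= size G)%N by lia.
  rewrite -(parent_rcons e) //; apply: (lab j) => //; try lia.
  by rewrite parent_rcons.
- move=> i j iG jG.
  have [iG' jG'] : (i <= size G)%N /\ (j <= size G)%N by lia.
  rewrite -(parent_rcons e iG') -(parent_rcons e jG') -(ident_rcons e iG')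
    -(ident_rcons e jG') => pij sij.
  by apply: labs => //; lia.
Qed.

(** If the parent of the new vertex were off the path to the last vertex, an edge of the path would
    step over its label. When the lower end of that edge was labeled, the parent still had an
    unlabeled child, the new vertex, and the labeling rule would have preferred it. On the path, the
    sibling conditions make the new identifier nonnegative and smaller than that of its sibling. *)
Lemma genogram_ext S G e : (0 < size G)%N -> is_genogram (rcons G e) ->
  e.2 <= S%:Z -> e \in ext S G.
Proof.
move=> G0 gGe eS; have gG := genogram_prefix G0 gGe.
have tG := genogram_treelike gG.
have sz : size (rcons G e) = (size G).+1 by rewrite size_rcons.
have pl := parent_rcons_last G e; have il := ident_rcons_last G e.
have [p0 pG] : (0 < e.1)%N /\ (e.1 <= size G)%N.
  have := genogram_tree gGe (j := (size G).+1) ltac:(rewrite sz; lia).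
  by rewrite pl; lia.
have e2 : -1 <= e.2 by rewrite -il; apply: genogram_ident => //; lia.
rewrite mem_ext; move: pG; rewrite leq_eqVlt => /predU1P[pG|pG].
  rewrite pG eqxx /=; have [/eqP e2E|e2'] := boolP (e.2 == -1); last first.
    by apply/orP; left; lia.
  rewrite e2E /=; have [//|G1] := ltnP 1 (size G).
  have := genogram_ident_root_child gGe (j := (size G).+1) ltac:(rewrite sz; lia).
  rewrite pl il => rch; have : e.1 = 1%N by lia.
  by move=> /rch; lia.
apply/orP; right; apply/orP; right.
have pA : e.1 \in lineage G (size G).
  have [c cL] := lineage_crossing tG (j := size G) (t := e.1) ltac:(lia).
  move=> /andP[pc ec]; have cG := mem_lineage tG G0 cL.
  move: ec; rewrite leq_eqVlt => /predU1P[->//|ec].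
  exfalso.
  apply: (genogram_labeling gGe (j := c.-1) (l := e.1) (i := (size G).+1)) => //;
    rewrite ?sz; try lia.
  by rewrite prednK ?parent_rcons; lia.
have [|c cL pc] := @lineage_child G (size G) e.1 tG.
  by move: pA; rewrite inE => /predU1P[|//]; lia.
have cG := mem_lineage tG G0 cL.
have c1 : (1 < c)%N.
  by have := tG c ltac:(lia); rewrite pc; lia.
have [] := genogram_ident_siblings gGe (i := c) (j := (size G).+1)
  ltac:(rewrite sz; lia)
  ltac:(rewrite sz; lia) ltac:(lia) _; first by rewrite pl parent_rcons //; lia.
rewrite il ident_rcons; last lia.
move=> c0 ce.
have [] := genogram_ident_siblings gGe (j := c) (i := (size G).+1)
  ltac:(rewrite sz; lia)
  ltac:(rewrite sz; lia) ltac:(lia) _; first by rewrite pl parent_rcons //; lia.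
rewrite il => e0 _.
apply/mem_side_ext; exists c; have [ec|ce'] := ltrP (ident G c) e.2.
  have := genogram_labeling_siblings gGe (j := c) (i := (size G).+1)
    ltac:(rewrite sz; lia) ltac:(rewrite sz; lia).
  by rewrite pl il parent_rcons ?ident_rcons; lia.
by split => //; lia.
Qed.

(** A sibling with a smaller identifier would be labeled after v[c]. At that moment the path below
    v[c] is unfinished: the edge stepping over the label j starts at a vertex with label at least c
    and an unlabeled child, which takes precedence over the parent of v[c]. *)
Lemma side_ext_siblings G c j : is_genogram G -> c \in lineage G (size G) ->
  1 <= ident G c -> (1 < j <= size G)%N -> parent G j = parent G c ->
  ident G c <= ident G j.
Proof.
move=> gG cL c1 jG pjc; have tG := genogram_treelike gG.
have G0 : (0 < size G)%N by lia.
have cG := mem_lineage tG G0 cL.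
have c2 : (1 < c)%N.
  case: ltnP => // c2; have c3 : c = 1%N by lia.
  by move: c1; rewrite c3; case: (genogram_root gG) => _ ->.
have pc := tG c ltac:(lia).
have [/eqP <- //|jc] := boolP (j == c).
have := genogram_ident_siblings gG (i := j) (j := c) ltac:(lia) ltac:(lia)
  ltac:(lia) pjc.
move=> [_ ne].
rewrite leNgt; apply/negP => lt.
have cj := genogram_labeling_siblings gG (i := c) (j := j) ltac:(lia) ltac:(lia)
  (esym pjc) lt.
have [c' c'L /and3P[cc' c'j jc']] :=
  lineage_crossing_above (t := j) tG G0 cL ltac:(lia).
have c'G := mem_lineage tG G0 c'L.
apply: (genogram_labeling gG (j := j.-1) (l := parent G c') (i := c')) => //;
  try lia.
by rewrite prednK; lia.
Qed.

Lemma leqS_case i n (Q : Prop) : ((i <= n)%N -> Q) -> (i = n.+1 -> Q) ->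
  (i <= n.+1)%N -> Q.
Proof. by rewrite [(i <= n.+1)%N]leq_eqVlt => h1 h2 /predU1P[/h2|/h1]. Qed.

Lemma ext_genogram S G e : is_genogram G -> e \in ext S G ->
  is_genogram (rcons G e).
Proof.
move=> gG eG; have tG := genogram_treelike gG; have G0 := genogram_nonempty gG.
have pl := parent_rcons_last G e; have il := ident_rcons_last G e.
have [r1 r2] := genogram_root gG.
have sideP : e \in side_ext G (size G) -> exists c,
    [/\ c \in lineage G (size G), (1 < c <= size G)%N, e.1 = parent G c,
      0 <= e.2 < ident G c & (0 < parent G c < c)%N].
  move=> /mem_side_ext[c [cL c1 ec c2]].
  have cG := mem_lineage tG G0 cL.
  have c2' : (1 < c)%N.
    case: ltnP => // c3; have c4 : c = 1%N by lia.
    by move: c1; rewrite c4 r2.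
  exists c; split => //; first lia.
  by apply: (genogram_tree gG); lia.
have e1G : (0 < e.1 <= size G)%N.
  move: eG; rewrite mem_ext => /or3P[/andP[/eqP -> _]|/and3P[/eqP -> _
    _]|/sideP]; try lia.
  by case=> c [_ cG -> _ pc]; lia.
have tGe : treelike (rcons G e) by apply: treelike_rcons => //; lia.
have e2G : -1 <= e.2.
  move: eG; rewrite mem_ext => /or3P[|/and3P[_ /eqP -> _]|/sideP[c []]]; try lia.
have sib j : (1 < j <= size G)%N -> parent G j = e.1 -> 0 <= e.2 < ident G j.
  move=> jG pj; move: eG; rewrite mem_ext.
  have pj' := tG j ltac:(lia).
  move=> /or3P[/andP[/eqP e1 _]|/and3P[/eqP e1 _ _]|/sideP]; try lia.
  move=> [c [cL cG ec c2 pc]].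
  have := side_ext_siblings gG cL ltac:(lia) jG ltac:(lia).
  lia.
split.
- by rewrite size_rcons.
- by rewrite parent_rcons // ident_rcons.
- move=> j; rewrite size_rcons => /andP[j2]; apply: leqS_case => [jG|->].
    by rewrite parent_rcons //; apply: (genogram_tree gG); lia.
  by rewrite pl; lia.
- move=> j; rewrite size_rcons => /andP[j2]; apply: leqS_case => [jG|->].
    by rewrite ident_rcons //; apply: (genogram_ident gG); lia.
  by rewrite il.
- move=> j; rewrite size_rcons => /andP[j2]; apply: leqS_case => [jG|->].
    rewrite parent_rcons // ident_rcons //.
    by apply: (genogram_ident_root_child gG); lia.
  rewrite pl il => e11; move: eG; rewrite mem_ext e11.
  move=> /or3P[|/and3P[/eqP s1 _ s2]|/sideP[c [_ _ _]]]; try lia.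
- move=> i j; rewrite size_rcons => /andP[i2]; apply: leqS_case => [iG|->]
  /andP[j2];
    apply: leqS_case => [jG|->] ij.
  + rewrite !parent_rcons // !ident_rcons //.
    by apply: (genogram_ident_siblings gG); lia.
  + by rewrite pl il parent_rcons // ident_rcons // => /sib; lia.
  + by rewrite pl il parent_rcons // ident_rcons // => /esym/sib; lia.
  + by [].
- move=> j l i; rewrite size_rcons => jG lj /andP[ji]; apply: leqS_case => [iG|->].
    rewrite parent_rcons //; rewrite parent_rcons in lj; last lia.
    by apply: (genogram_labeling gG (j := j)) => //; lia.
  rewrite pl => el; subst l.
  have [jG'|jG'] := ltnP j (size G); last first.
    have jE : j = size G by lia.
    by rewrite jE pl ltnn in lj.
  rewrite parent_rcons in lj; last lia.
  move: eG; rewrite mem_ext => /or3P[/andP[/eqP e1 _]|/and3P[/eqP e1 _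
    _]|/sideP]; try lia.
  move=> [c [cL cG ec _ pc]].
  (* If j < c, then v[c] is itself a still unlabeled child of v[l] in [G]. Otherwise the path edge
     over j + 1 provides a vertex with label at least c and an unlabeled child. Both contradict the
     labeling rule for [G]. *)
  have [cj|jc] := ltnP j c.
    by apply: (genogram_labeling gG (j := j) (l := e.1) (i := c)); lia.
  have [c' c'L /and3P[cc' c'j jc']] :=
    lineage_crossing_above (t := j.+1) tG G0 cL ltac:(lia).
  have c'G := mem_lineage tG G0 c'L.
  by apply: (genogram_labeling gG (j := j) (l := parent G c') (i := c')); lia.
- move=> i j; rewrite size_rcons => /andP[i2]; apply: leqS_case => [iG|->]
  /andP[j2];
    apply: leqS_case => [jG|->].
  + rewrite !parent_rcons // !ident_rcons //.
    by apply: (genogram_labeling_siblings gG); lia.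
  + by lia.
  + by rewrite pl il parent_rcons // ident_rcons // => /esym/sib; lia.
  + by rewrite ltxx.
Qed.

(* The genograms of order [n.+1], not [n], with identifiers at most [S]. *)
Fixpoint gens (S n : nat) : seq genogram :=
  if n is n'.+1 then [seq rcons H e | H <- gens S n', e <- ext S H]
  else [:: [:: (0%N, 0)]].

Lemma genogram_unit : is_genogram [:: (0%N, 0)].
Proof.
split=> //=.
- by move=> j; case/andP; case: j => [|[|]].
- by move=> j; case/andP; case: j => [|[|]].
- by move=> j; case/andP; case: j => [|[|]].
- by move=> i j; case/andP; case: i => [|[|]].
- by move=> j l i; lia.
- by move=> i j; case/andP; case: i => [|[|]].
Qed.

Lemma mem_gensS S n G : reflect
  (exists H e, [/\ H \in gens S n, e \in ext S H & G = rcons H e])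
  (G \in gens S n.+1).
Proof.
apply: (iffP allpairsPdep) => -[H [e [h1 h2 h3]]]; exists H, e; split=> //.
Qed.

Lemma gens_genogram S n G : G \in gens S n -> is_genogram G /\ size G = n.+1.
Proof.
elim: n G => [|n IH] G.
  by rewrite mem_seq1 => /eqP ->; split=> //; exact: genogram_unit.
move=> /mem_gensS[H [e [/IH[gH sH] eH ->]]]; split; last by rewrite size_rcons sH.
exact: ext_genogram eH.
Qed.

Lemma gens_uniq S n : uniq (gens S n).
Proof.
elim: n => [//|n IH]; rewrite [gens _ _]/=.
apply: (@allpairs_uniq_dep _ (fun=> (nat * int)%type) _
  (fun H e => rcons H e) (gens S n) (ext S)) => // [H /gens_genogram[gH sH]|].
  by apply: ext_uniq; [exact: genogram_treelike | rewrite sH].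
by move=> [H e] [H' e'] _ _ /= /eqP; rewrite eqseq_rcons => /andP[/eqP -> /eqP ->].
Qed.

Lemma genogram_gens S n G : is_genogram G -> size G = n.+1 ->
  (forall j, ident G j <= S%:Z) -> G \in gens S n.
Proof.
elim: n G => [|n IH] G.
  case: G => [//|[p s] [|//]] gG _ _; rewrite mem_seq1.
  by case: (genogram_root gG); rewrite /parent /ident /= => -> ->.
case/lastP: G => // G e gG; rewrite size_rcons => -[sG] GS.
have G0 : (0 < size G)%N by rewrite sG.
apply/mem_gensS; exists G, e; split => //.
  apply: IH => //; first exact: genogram_prefix gG.
  move=> j; have [jG|jG] := leqP j (size G).
    by rewrite -(ident_rcons e jG).
  by rewrite /ident /entry nth_default.
by apply: genogram_ext => //; rewrite -(ident_rcons_last G e).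
Qed.

(** The filter looks only at the prefix, so with each selected genogram all its extensions are
    summed. This allows part of a generation to be expanded. *)
Lemma big_gensS (V : nmodType) S n (F : genogram -> V) (A : pred genogram) :
  \sum_(G <- gens S n.+1 | A (take n.+1 G)) F G =
  \sum_(H <- gens S n | A H) \sum_(e <- ext S H) F (rcons H e).
Proof.
rewrite [LHS]big_mkcond [gens _ _]/= [RHS]big_mkcond /=.
rewrite (@big_allpairs_dep _ _ _ _ (fun=> (nat * int)%type) _
  (fun H e => rcons H e) (gens S n) (ext S)).
apply: eq_big_seq => H /gens_genogram[_ sH].
rewrite -[n.+1]sH; under eq_bigr do rewrite -cats1 take_size_cat // cats1.
by case: ifP => // _; rewrite big1.
Qed.

(** * Leaves, signs and the coefficient b *)

Definition is_leaf G j := all (fun i => parent G i != j) (iota 1 (size G)).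

Lemma gammaE G : gamma G = count (is_leaf G) (iota 1 (size G)).
Proof. by rewrite /gamma size_filter. Qed.

Lemma iota1_rcons n : iota 1 n.+1 = rcons (iota 1 n) n.+1.
Proof. by rewrite -(addn1 n) iotaD cats1 add1n addn1. Qed.

Lemma is_leaf_rcons G e j : is_leaf (rcons G e) j = is_leaf G j && (e.1 != j).
Proof.
rewrite /is_leaf size_rcons iota1_rcons all_rcons parent_rcons_last andbC.
congr (_ && _); apply: eq_in_all => i; rewrite mem_iota => iG.
by rewrite parent_rcons //; lia.
Qed.

Lemma is_leaf_last G j : treelike G -> (size G <= j)%N -> is_leaf G j.
Proof.
move=> tG jG; apply/allP => i; rewrite mem_iota => iG.
by have := tG i ltac:(lia); lia.
Qed.

(** The last vertex is a leaf and loses this status to its new child. *)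
Lemma gamma_rcons_new G e : treelike G -> (0 < size G)%N -> e.1 = size G ->
  gamma (rcons G e) = gamma G.
Proof.
move=> tG G0 eG; rewrite !gammaE size_rcons iota1_rcons -[rcons (iota _ _)
  _]cats1 count_cat /=.
rewrite is_leaf_rcons is_leaf_last // eG neq_ltn ltnSn addn0 /=.
rewrite -[X in iota 1 X](prednK G0) iota1_rcons prednK // -[rcons (iota _ _)
  _]cats1 !count_cat /=.
rewrite is_leaf_rcons eG eqxx andbF is_leaf_last // !addn0; congr (_ + _)%N.
apply: eq_in_count => j; rewrite mem_iota => jG; rewrite is_leaf_rcons eG.
by case: eqP => [jE|]; rewrite ?andbT //; lia.
Qed.

(** The parent already has the child v[c], so no leaf is lost. *)
Lemma gamma_rcons_side G e c : treelike G -> (0 < c <= size G)%N ->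
  e.1 = parent G c -> gamma (rcons G e) = (gamma G).+1.
Proof.
move=> tG cG ec; rewrite !gammaE size_rcons iota1_rcons -[rcons (iota _ _)
  _]cats1 count_cat /=.
have pc := tG c ltac:(lia).
rewrite is_leaf_rcons is_leaf_last // ec neq_ltn; have -> /= : (parent G c <
  (size G).+1)%N by lia.
rewrite addn1; congr _.+1.
apply: eq_in_count => j _; rewrite is_leaf_rcons ec.
case: eqP => [jE|]; rewrite ?andbT // andbF.
by apply/esym/allPn; exists c; rewrite ?mem_iota ?jE ?eqxx //; lia.
Qed.

Lemma tau_rcons G e : tau (rcons G e) = (tau G + (e.2 == - 1)%R)%N.
Proof.
rewrite /tau size_rcons iota1_rcons -[rcons (iota _ _) _]cats1 count_cat /=
  addn0 ident_rcons_last.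
congr (_ + _)%N; apply: eq_in_count => j; rewrite mem_iota => jG.
by rewrite ident_rcons //; lia.
Qed.

Variable R : realType.

(** The product in [bcoef] stops before the last vertex, so the factor of that vertex enters only on
    extension. It is the factor that integration by parts of the remainder at the last vertex
    produces. *)
Lemma bcoef_rcons G e (b : bool) : treelike G -> (1 < size G)%N ->
  ((gamma (rcons G e) + tau (rcons G e)) = gamma G + tau G + b)%N ->
  bcoef R (rcons G e) =
  (-1) ^+ b * (bcoef R G / ((size G).+1 - uidx G (size G))%N%:R).
Proof.
move=> tG G1 sg; rewrite /bcoef sg size_rcons exprD big_nat_recr //=.
rewrite uidx_rcons //; last lia.
under eq_big_nat => j jG.
  rewrite uidx_rcons; [|done|lia].
  over.
by rewrite !mulrA; congr (_ * _); rewrite [_ ^+ b * _]mulrC -!mulrA; congr (_ * _).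
Qed.

(** The change in the parity of gamma + tau: a side vertex adds a leaf, identifier -1 adds one to
    tau, and the remaining extensions change neither. *)
Definition ext_sign G e : bool := (e.1 != size G) || (e.2 == - 1).

Lemma ext_parity S G e : is_genogram G -> e \in ext S G ->
  (gamma (rcons G e) + tau (rcons G e) = gamma G + tau G + ext_sign G e)%N.
Proof.
move=> gG; have tG := genogram_treelike gG; have G0 := genogram_nonempty gG.
rewrite mem_ext tau_rcons /ext_sign.
move=> /or3P[/andP[/eqP e1 e2]|/and3P[/eqP e1 e2 _]|].
- by rewrite gamma_rcons_new // e1 eqxx /=; lia.
- by rewrite gamma_rcons_new // e1 eqxx /=; lia.
move=> /mem_side_ext[c [cL c1 ec e2]].
have cG := mem_lineage tG G0 cL; have pc := tG c ltac:(lia).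
rewrite (gamma_rcons_side (c := c)) // ec.
have -> : parent G c != size G by lia.
have -> : (e.2 == - 1) = false by lia.
by rewrite /=; lia.
Qed.

Lemma bcoef_ext S G e : is_genogram G -> (1 < size G)%N -> e \in ext S G ->
  bcoef R (rcons G e) = (-1) ^+ ext_sign G e *
    (bcoef R G / ((size G).+1 - uidx G (size G))%N%:R).
Proof.
move=> gG G1 eG; apply: bcoef_rcons => //; first exact: genogram_treelike.
exact: ext_parity eG.
Qed.

Lemma bcoef_ext_unit S e : e \in ext S [:: (0%N, 0)] ->
  bcoef R (rcons [:: (0%N, 0)] e) = -1.
Proof.
move=> eG; rewrite /bcoef (ext_parity genogram_unit eG) /= big_geq // mulr1.
move: eG; rewrite mem_ext /= => /or3P[/andP[/eqP e1 e2]|/and3P[//]|].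
  rewrite /ext_sign e1 /=; have -> : (e.2 == - 1) = false by lia.
  by rewrite /gamma /tau /leaves /= expr1.
by move=> /mem_side_ext[c [/=]]; rewrite inE => /eqP ->.
Qed.

End Labels.

(** * The constraint sets *)

Section ConstraintSets.
Variables (d m : nat) (prec : rel 'rV[int]_d) (T : {fset 'rV[int]_d}).
Hypothesis prec_irr : irreflexive prec.
Implicit Types (e : nat * int) (J : {fset 'rV[int]_d}) (G : genogram) (ii : seq
  'rV[int]_d).

Lemma nbhds_sub s J : nbhds m prec T s J `<=` T.
Proof.
apply/fsubsetP => i; rewrite !inE => /orP[/andP[]//|].
by move=> /andP[/andP[_ ->]].
Qed.

Lemma nbhds_mono s s' J : (s <= s')%N ->
  nbhds m prec T s J `<=` nbhds m prec T s' J.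
Proof.
move=> ss; apply/fsubsetP => i; rewrite /nbhds !in_fsetU => /orP[->//|].
rewrite !inE => /andP[-> /leq_trans ->//]; exact: orbT.
Qed.

(** The points before i form a proper subset of T, as i does not precede itself; so its rank is at
    most |T|. *)
Lemma nbhds_full s J : (#|` T| <= s)%N -> nbhds m prec T s J = T.
Proof.
move=> Ts; apply/eqP; rewrite eqEfsubset nbhds_sub; apply/fsubsetP => i iT.
rewrite /nbhds in_fsetU; have [//|iN /=] := boolP (i \in nbhd m T J).
move: iN; rewrite !inE iT /= => -> /=; apply: leq_trans Ts; rewrite /rk.
apply: fproper_ltn_card; rewrite fproperE; apply/andP; split.
  by apply/fsubsetP => x; rewrite !inE => /andP[/andP[_ ->]].
apply/fsubsetPn; exists i => //; rewrite !inE /before ltnn eqxx prec_irr /=.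
by rewrite andbF.
Qed.

Local Notation D := (Dset m prec T).
Local Notation B := (Bset m prec T).

Lemma Dset_rec_fuel G ii n j : treelike G -> (j <= n)%N ->
  Dset_rec m prec T G ii n j = D G ii j.
Proof.
move=> tG; elim/ltn_ind: n j => n IH [|j] jn.
  by case: n {IH} jn.
case: n jn IH => // n jn IH; rewrite /Dset /=; case: ifP => // j1.
have gj := gidx_lt tG (j := j.+1) ltac:(lia).
by rewrite !IH //; lia.
Qed.

Lemma DsetE_gidx G ii j : treelike G -> (1 < j)%N ->
  D G ii j = (if 1 <= ident G j then
    nbhds m prec T (`|ident G j|%N).-1 (ancestor_points G ii j)
    else fset0) `|` D G ii (gidx G j).
Proof.
move=> tG; case: j => // j j1; rewrite {1}/Dset /= leqNgt j1 /=.
have gj := gidx_lt tG j1.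
by rewrite Dset_rec_fuel //; case: ifP; rewrite ?fset0U.
Qed.

Lemma Dset1 G ii : D G ii 1 = fset0.
Proof. by []. Qed.

(** Between v[g(j)] and the parent, identifiers above v[g(j)] are nonpositive and D stays the same.
    The recursion may thus run through parents, which suits induction along the tree. *)
Lemma Dset_gidx G ii j : treelike G -> (0 < parent G j)%N ->
  D G ii (gidx G j) = D G ii (parent G j).
Proof.
move=> tG p0; rewrite gidxE //; case: ifP => // s0.
have [p1|p1] := leqP (parent G j) 1.
  have -> : parent G j = 1%N by lia.
  by rewrite gidx_root //; have := tG 1%N isT; lia.
by rewrite [RHS]DsetE_gidx // s0 fset0U.
Qed.

Lemma DsetE G ii j : treelike G -> (0 < parent G j < j)%N ->
  D G ii j = (if 1 <= ident G j then
    nbhds m prec T (`|ident G j|%N).-1 (ancestor_points G ii j)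
    else fset0) `|` D G ii (parent G j).
Proof. by move=> tG pj; rewrite DsetE_gidx ?Dset_gidx //; lia. Qed.

Lemma BsetE_nonneg G ii j : treelike G -> (0 < parent G j < j)%N ->
  0 <= ident G j ->
  B G ii j = nbhds m prec T `|ident G j|%N (ancestor_points G ii j)
    `|` D G ii (parent G j).
Proof.
move=> tG pj sj; case: j pj sj => // j pj sj.
rewrite {1}/Bset /= leqNgt; have -> /= : (1 < j.+1)%N by lia.
by rewrite sj -Dset_gidx //; lia.
Qed.

Lemma Bset_rec_uidx G ii j n : treelike G -> 0 <= ident G j -> (0 < j <= n)%N ->
  Bset_rec m prec T G ii n j = B G ii j.
Proof.
move=> tG sj; case: j sj => // j sj jn.
by case: n jn => // n jn; rewrite /Bset /= sj; case: ifP.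
Qed.

Lemma uidx_prop G j : is_genogram G -> (0 < j <= size G)%N ->
  (0 < uidx G j <= j)%N /\ 0 <= ident G (uidx G j).
Proof.
move=> gG; have tG := genogram_treelike gG; elim/ltn_ind: j => j IH jG.
have [s0|s0] := lerP 0 (ident G j); first by rewrite uidx_nonneg //; lia.
have j1 : (1 < j)%N.
  case: ltnP => // j1; have jE : j = 1%N by lia.
  by move: s0; rewrite jE; case: (genogram_root gG) => _ ->.
have pj := genogram_tree gG (j := j) ltac:(lia).
by have [] := IH (parent G j) ltac:(lia) ltac:(lia); rewrite -uidx_neg //; lia.
Qed.

(** A vertex with identifier -1 shares u with its parent, and both sets reduce to B at that common
    label. *)
Lemma BsetE_neg G ii j : is_genogram G -> (1 < j <= size G)%N ->
  ident G j < 0 -> B G ii j = B G ii (parent G j).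
Proof.
move=> gG jG sj; have tG := genogram_treelike gG.
have pj := genogram_tree gG (j := j) ltac:(lia).
have uE : uidx G j = uidx G (parent G j) by apply: uidx_neg => //; lia.
have [up su] := uidx_prop gG (j := parent G j) ltac:(lia).
have -> : B G ii j = B G ii (uidx G j).
  case: j jG sj pj uE {up su} (uidx_prop gG (j := j) ltac:(lia)) => // j.
  move=> jG sj pj uE [up su]; rewrite {1}/Bset /= leqNgt.
  have -> /= : (1 < j.+1)%N by lia.
  rewrite leNgt sj /= Bset_rec_uidx //.
  have := uidx_neg tG (j := j.+1) ltac:(lia) sj => {}uE.
  have [] := uidx_prop gG (j := parent G j.+1) ltac:(lia); rewrite -uE; lia.
rewrite uE; have [sp|sp] := lerP 0 (ident G (parent G j)).
  by rewrite uidx_nonneg.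
case: (parent G j) pj sp up su => // p pj sp up su.
rewrite [in RHS]/Bset /=; case: ifP => p1.
  have -> : uidx G p.+1 = 1%N by lia.
  by [].
rewrite leNgt sp /= Bset_rec_uidx //.
have p0 := genogram_tree gG (j := p.+1) ltac:(lia).
have uE' := uidx_neg tG (j := p.+1) ltac:(lia) sp.
by have [] := uidx_prop gG (j := parent G p.+1) ltac:(lia); rewrite -uE'; lia.
Qed.

Lemma Dset_sub G ii j : is_genogram G -> (0 < j <= size G)%N -> D G ii j `<=` T.
Proof.
move=> gG; have tG := genogram_treelike gG; elim/ltn_ind: j => j IH jG.
have [j1|j1] := leqP j 1.
  by have -> : j = 1%N by lia.
have pj := genogram_tree gG (j := j) ltac:(lia).
rewrite DsetE // fsubUset IH ?andbT; try lia.
by case: ifP; rewrite ?nbhds_sub ?fsub0set.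
Qed.

Lemma Bset_sub G ii j : is_genogram G -> (0 < j <= size G)%N -> B G ii j `<=` T.
Proof.
move=> gG; have tG := genogram_treelike gG; elim/ltn_ind: j => j IH jG.
have [j1|j1] := leqP j 1.
  by have -> : j = 1%N by lia.
have pj := genogram_tree gG (j := j) ltac:(lia).
have [sj|sj] := lerP 0 (ident G j).
  by rewrite BsetE_nonneg // fsubUset nbhds_sub Dset_sub //; lia.
by rewrite (BsetE_neg _ gG) ?IH //; lia.
Qed.

Lemma Dset_sub_Bset G ii j : is_genogram G -> (0 < j <= size G)%N ->
  D G ii j `<=` B G ii j.
Proof.
move=> gG; have tG := genogram_treelike gG; elim/ltn_ind: j => j IH jG.
have [j1|j1] := leqP j 1.
  by have -> : j = 1%N by lia.
have pj := genogram_tree gG (j := j) ltac:(lia).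
have [sj|sj] := lerP 0 (ident G j).
  rewrite BsetE_nonneg // DsetE //; apply: fsetUSS => //.
  by case: ifP; rewrite ?fsub0set // => _; apply: nbhds_mono; lia.
rewrite (BsetE_neg _ gG) //; last lia.
rewrite DsetE //.
have -> : (1 <= ident G j) = false by lia.
by rewrite fset0U IH //; lia.
Qed.

Lemma ancestor_points_rcons G e ii j : treelike G -> (0 < j <= size G)%N ->
  ancestor_points (rcons G e) ii j = ancestor_points G ii j.
Proof. by move=> tG jG; rewrite /ancestor_points ancestors_rcons. Qed.

(** The appended point has label at least j, while the ancestors of v[j] have smaller labels. Hence
    B_j and D_j depend on the points before i_j only. *)
Lemma ancestor_points_local G ii i j : treelike G -> (0 < j <= (size ii).+1)%N ->
  ancestor_points G (rcons ii i) j = ancestor_points G ii j.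
Proof.
move=> tG jG; apply: eq_in_imfset => //= l /(mem_ancestors tG) lj.
by rewrite nth_rcons ifT //; lia.
Qed.

Lemma Dset_rcons G e ii j : is_genogram G -> (e.1 <= size G)%N ->
  (0 < j <= size G)%N -> D (rcons G e) ii j = D G ii j.
Proof.
move=> gG eG; have tG := genogram_treelike gG.
have tGe : treelike (rcons G e) by apply: treelike_rcons.
elim/ltn_ind: j => j IH jG; have [j1|j1] := leqP j 1.
  by have -> : j = 1%N by lia.
have pj := genogram_tree gG (j := j) ltac:(lia).
have jG' : (j <= size G)%N by lia.
rewrite DsetE ?parent_rcons // ident_rcons // ancestor_points_rcons // IH; try lia.
by rewrite -DsetE.
Qed.

Lemma Bset_rcons S G e ii j : is_genogram G -> e \in ext S G ->
  (0 < j <= size G)%N -> B (rcons G e) ii j = B G ii j.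
Proof.
move=> gG eG; have tG := genogram_treelike gG.
have gGe := ext_genogram gG eG.
have tGe := genogram_treelike gGe.
have e1 : (e.1 <= size G)%N.
  have := tGe (size G).+1 isT; rewrite parent_rcons_last; lia.
elim/ltn_ind: j => j IH jG; have [j1|j1] := leqP j 1.
  by have -> : j = 1%N by lia.
have pj := genogram_tree gG (j := j) ltac:(lia).
have jG' : (j <= size G)%N by lia.
have [sj|sj] := lerP 0 (ident G j).
  rewrite BsetE_nonneg ?parent_rcons ?ident_rcons //.
  by rewrite ancestor_points_rcons // Dset_rcons -?BsetE_nonneg //; lia.
have jGe : (1 < j <= size (rcons G e))%N by rewrite size_rcons; lia.
rewrite (@BsetE_neg _ _ j gG) ?(@BsetE_neg _ _ j gGe) ?ident_rcons //; last lia.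
by rewrite parent_rcons // IH //; lia.
Qed.

Lemma Dset_local G ii i j : is_genogram G -> (0 < j <= size G)%N ->
  (j <= (size ii).+1)%N -> D G (rcons ii i) j = D G ii j.
Proof.
move=> gG; have tG := genogram_treelike gG.
elim/ltn_ind: j => j IH jG ji; have [j1|j1] := leqP j 1.
  by have -> : j = 1%N by lia.
have pj := genogram_tree gG (j := j) ltac:(lia).
rewrite [LHS]DsetE // [RHS]DsetE // ancestor_points_local; [|done|lia].
by rewrite IH //; lia.
Qed.

Lemma Bset_local G ii i j : is_genogram G -> (0 < j <= size G)%N ->
  (j <= (size ii).+1)%N -> B G (rcons ii i) j = B G ii j.
Proof.
move=> gG; have tG := genogram_treelike gG.
elim/ltn_ind: j => j IH jG ji; have [j1|j1] := leqP j 1.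
  by have -> : j = 1%N by lia.
have pj := genogram_tree gG (j := j) ltac:(lia).
have [sj|sj] := lerP 0 (ident G j).
  rewrite [LHS]BsetE_nonneg // [RHS]BsetE_nonneg // ancestor_points_local;
    [|done|lia].
  by rewrite Dset_local //; lia.
rewrite [LHS](BsetE_neg _ gG) //; last lia.
by rewrite [RHS](BsetE_neg _ gG) ?IH //; lia.
Qed.

(** * The index sets of the iterated sums *)

Local Notation I := (indices m prec T).

Lemma indicesP G n jj : reflect
  (exists ii i, [/\ ii \in I G n, i \in B G ii n.+1 `\` D G ii n.+1
                  & jj = rcons ii i])
  (jj \in I G n.+1).
Proof. by apply: (iffP allpairsPdep) => -[ii [i [h1 h2 h3]]]; exists ii, i. Qed.

Lemma big_indicesS (V : nmodType) G n (F : seq 'rV[int]_d -> V) :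
  \sum_(jj <- I G n.+1) F jj =
  \sum_(ii <- I G n) \sum_(i <- B G ii n.+1 `\` D G ii n.+1) F (rcons ii i).
Proof. by rewrite /= big_allpairs_dep. Qed.

Lemma size_indices G n ii : ii \in I G n -> size ii = n.
Proof.
elim: n ii => [|n IH] ii; first by rewrite mem_seq1 => /eqP ->.
by move=> /indicesP[jj [i [/IH sj _ ->]]]; rewrite size_rcons sj.
Qed.

Lemma indices_mem G n ii : is_genogram G -> (n <= size G)%N -> ii \in I G n ->
  {in ii, forall i, i \in T}.
Proof.
move=> gG; elim: n ii => [|n IH] ii nG; first by rewrite mem_seq1 => /eqP ->.
move=> /indicesP[jj [i [jI iB ->]]] x; rewrite mem_rcons inE => /predU1P[->|].
  move: iB; rewrite in_fsetD => /andP[_].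
  by apply/fsubsetP/Bset_sub => //; lia.
by apply: (IH jj) => //; lia.
Qed.

Lemma indices_rcons S G e n : is_genogram G -> e \in ext S G ->
  (n <= size G)%N -> I (rcons G e) n = I G n.
Proof.
move=> gG eG; have gGe := ext_genogram gG eG.
have e1 : (e.1 <= size G)%N.
  have := genogram_treelike gGe (j := (size G).+1) isT.
  by rewrite parent_rcons_last; lia.
elim: n => [//|n IH] nG; rewrite /= IH; last lia.
congr flatten; apply: eq_map => ii; congr map.
by rewrite (Bset_rcons _ gG eG) // Dset_rcons.
Qed.

(** The strict inequality makes s_j - 1 at least |T| as well, so D_j is full along with B_j. *)
Lemma Dset_saturated G ii j : treelike G -> (0 < parent G j < j)%N ->
  D G ii (parent G j) `<=` T ->
  #|` T|%:Z < ident G j -> D G ii j = T /\ B G ii j = T.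
Proof.
move=> tG pj DT sj; rewrite DsetE // BsetE_nonneg //; try lia.
have -> : 1 <= ident G j by lia.
rewrite !nbhds_full; try lia.
by split; apply/fsetUidPl.
Qed.

Lemma indices_saturated G n j : is_genogram G -> (1 < j <= n)%N ->
  (n <= size G)%N -> #|` T|%:Z < ident G j -> I G n = [::].
Proof.
move=> gG jn nG sj.
have tG := genogram_treelike gG.
have pj := genogram_tree gG (j := j) ltac:(lia).
have base : I G j = [::].
  case: j jn sj pj => // j jn sj pj; rewrite /=.
  elim: (indices _ _ _ _ _) => //= ii s ->.
  have [DE BE] := @Dset_saturated G ii j.+1 tG ltac:(lia)
    (Dset_sub ii gG (j := parent G j.+1) ltac:(lia)) sj.
  rewrite DE BE fsetDv.
  by rewrite cats0.
have [j1 {}jn] : (1 < j /\ j <= n)%N by lia.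
elim: n {nG} jn => [|n IH] jn; first lia.
move: jn; rewrite leq_eqVlt => /predU1P[<-//|jn].
by rewrite /= IH.
Qed.

End ConstraintSets.

(** * The blocks of the last factor *)

Section LastBlocks.
Implicit Types (G : genogram) (e : nat * int).

Lemma iota_rcons a n : iota a n.+1 = rcons (iota a n) (a + n)%N.
Proof. by rewrite -(addn1 n) iotaD cats1. Qed.

Lemma qzero_bounds G : (0 < size G)%N -> (0 < qzero G <= size G)%N.
Proof.
move=> G0; rewrite /qzero big_cons leq_max /= geq_max G0 /=.
apply/bigmax_leqP_seq => j; rewrite mem_filter mem_iota => /andP[_ jG] _; lia.
Qed.

Lemma qzero_rcons G e : (0 < size G)%N -> 
  qzero (rcons G e) = if e.1 == size G then qzero G else (size G).+1.
Proof.
move=> G0; rewrite /qzero size_rcons /=.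
rewrite -[X in iota 2 X](prednK G0) iota_rcons filter_rcons.
have -> : (2 + (size G).-1 = (size G).+1)%N by lia.
rewrite parent_rcons_last /=.
have -> : [seq j <- iota 2 (size G).-1 | parent (rcons G e) j != j.-1] =
          [seq j <- iota 2 (size G).-1 | parent G j != j.-1].
  apply: eq_in_filter => j; rewrite mem_iota => jG.
  by rewrite parent_rcons //; lia.
have := qzero_bounds G0; rewrite /qzero; case: eqP => //= _.
rewrite !big_cons -cats1 big_cat big_seq1 maxnA => /andP[_ h].
by apply/maxn_idPr; apply: leq_trans h _.
Qed.

(** The three kinds of extension act differently on the last factor: a child of the last vertex with
    nonnegative identifier opens a new argument, identifier -1 enlarges the last argument, and any
    other parent starts a new factor. *)
Lemma qseq_rcons G e : (0 < size G)%N ->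
  qseq (rcons G e) = if e.1 == size G
    then qseq G ++ (if 0 <= e.2 then [:: (size G).+1] else [::])
    else [:: (size G).+1].
Proof.
move=> G0; have /andP[q0 qG] := qzero_bounds G0.
rewrite /qseq qzero_rcons // size_rcons; case: eqP => _; last by rewrite subnn.
rewrite subSn // iota_rcons filter_rcons.
have -> : ((qzero G).+1 + (size G - qzero G) = (size G).+1)%N by lia.
rewrite ident_rcons_last /=; congr cons.
have -> : [seq t <- iota (qzero G).+1 (size G - qzero G) | (0 <= ident (rcons G
  e) t)%R] =
          [seq t <- iota (qzero G).+1 (size G - qzero G) | (0 <= ident G t)%R].
  apply: eq_in_filter => j; rewrite mem_iota => jG.
  by rewrite ident_rcons //; lia.
by case: ifP; rewrite ?cats1 ?cats0.
Qed.

Lemma qseq_le G q : (0 < size G)%N -> q \in qseq G -> (0 < q <= size G)%N.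
Proof.
move=> G0; rewrite inE => /predU1P[->|]; first exact: qzero_bounds.
have := qzero_bounds G0; rewrite mem_filter mem_iota; lia.
Qed.

Lemma qseq_unit e : qseq [:: e] = [:: 1%N].
Proof.
rewrite /qseq; have -> : qzero [:: e] = 1%N.
  by have := qzero_bounds (G := [:: e]) isT; rewrite /=; lia.
by [].
Qed.

Context {disp : measure_display} {Omega : measurableType disp} {R : realType}.
Implicit Type (Y : seq (Omega -> R)) (y z : Omega -> R).

Definition block Y (q : nat * nat) : Omega -> R :=
  fun w => \prod_(q.1 <= t < q.2) nth (fun=> 0) Y t.-1 w.

Definition qpairs (s : seq nat) n := zip s (rcons (behead s) n).

Lemma last_blocksE G Y :
  last_blocks G Y = [seq block Y q | q <- qpairs (qseq G) (size G).+1].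
Proof. by []. Qed.

Lemma qpairsE s n : s != [::] ->
  qpairs s n = rcons (zip s (behead s)) (last 0%N s, n).
Proof.
case: s => // a s _; rewrite /qpairs /=; elim: s a => //= b s IH a.
by rewrite IH.
Qed.

Lemma block_rcons Y z q : (0 < q.1)%N -> (q.2 <= (size Y).+1)%N ->
  block (rcons Y z) q = block Y q.
Proof.
move=> q0 qY; apply/funext => w; rewrite /block; apply: eq_big_nat => t tq.
have tY : (t.-1 < size Y)%N by lia.
by rewrite nth_rcons ifT.
Qed.

Lemma block_recr Y y a : (0 < a <= (size Y).+1)%N ->
  block (rcons Y y) (a, (size Y).+2) =
  fun w => block Y (a, (size Y).+1) w * y w.
Proof.
move=> /andP[a0 aY]; rewrite -(@block_rcons Y y) //; apply/funext => w.
by rewrite /block /= big_nat_recr //= nth_rcons ltnn eqxx.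
Qed.

(** These are the arguments of the last factor before its final one. The final argument is
    [last_block] times Y_k; the product in [last_block] ends before label k and is empty, hence 1,
    if v[k] opens that argument. *)
Definition init_blocks G Y : seq (Omega -> R) :=
  [seq block Y q | q <- zip (qseq G) (behead (qseq G))].
Definition last_block G Y : Omega -> R := block Y (last 0%N (qseq G), size G).

Lemma mem_zip (s t : seq nat) q : q \in zip s t -> q.1 \in s /\ q.2 \in t.
Proof.
elim: s t => [|a s IH] [|b t] //=; rewrite inE => /predU1P[->|/IH[h1 h2]].
  by rewrite !mem_head.
by rewrite !inE h1 h2 !orbT.
Qed.

Lemma init_blocks_rcons G Y y : (0 < size G)%N -> (size G <= (size Y).+1)%N ->
  init_blocks G (rcons Y y) = init_blocks G Y.
Proof.
move=> G0 GY; apply/eq_in_map => q /mem_zip[q1 /mem_behead q2].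
have /andP[q0 _] := qseq_le G0 q1; have /andP[_ qG] := qseq_le G0 q2.
by apply: block_rcons => //; exact: leq_trans qG GY.
Qed.

Lemma last_qseq G : (0 < size G)%N -> (0 < last 0 (qseq G) <= size G)%N.
Proof.
move=> G0; apply: qseq_le => //.
by rewrite /qseq /= mem_last.
Qed.

Lemma last_blocks_split G Y y : (size Y).+1 = size G ->
  last_blocks G (rcons Y y) =
  rcons (init_blocks G Y) (fun w => last_block G Y w * y w).
Proof.
move=> YG; have G0 : (0 < size G)%N by rewrite -YG.
have /andP[l0 lG] := last_qseq G0.
rewrite last_blocksE qpairsE // map_rcons -/(init_blocks _ _) init_blocks_rcons
  //; last by rewrite YG.
by rewrite /last_block -YG block_recr // l0 YG.
Qed.

Lemma last_blocks_neg G e Y y z : (size Y).+1 = size G -> e.1 = size G -> e.2 < 0 ->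
  last_blocks (rcons G e) (rcons (rcons Y y) z) =
  rcons (init_blocks G Y) (fun w => last_block G Y w * (y w * z w)).
Proof.
move=> YG e1 e2; have G0 : (0 < size G)%N by rewrite -YG.
rewrite last_blocks_split; last by rewrite !size_rcons YG.
have qE : qseq (rcons G e) = qseq G by rewrite qseq_rcons // e1 eqxx leNgt e2 cats0.
have -> : init_blocks (rcons G e) (rcons Y y) = init_blocks G Y.
  by rewrite /init_blocks qE -/(init_blocks _ _) init_blocks_rcons ?YG.
congr rcons; apply/funext => w; rewrite mulrA; congr (_ * _).
have /andP[l0 lG] := last_qseq G0.
by rewrite /last_block qE size_rcons -YG block_recr // l0 YG.
Qed.

Lemma last_blocks_nonneg G e Y z : size Y = size G -> (0 < size G)%N ->
  e.1 = size G -> 0 <= e.2 ->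
  last_blocks (rcons G e) (rcons Y z) = rcons (last_blocks G Y) z.
Proof.
move=> YG G0 e1 e2; rewrite last_blocks_split ?size_rcons ?YG //.
have qE : qseq (rcons G e) = rcons (qseq G) (size G).+1.
  by rewrite qseq_rcons // e1 eqxx e2 cats1.
congr rcons.
  rewrite /init_blocks last_blocksE qE; congr map.
  rewrite /qpairs -/(qpairs _ _).
  have : qseq G != [::] by [].
  case: (qseq G) => // a s _ /=.
  elim: s a => //= b s IH a; congr cons; exact: IH.
apply/funext => w; rewrite /last_block qE last_rcons size_rcons /block /=.
by rewrite big_geq // mul1r.
Qed.

Lemma last_blocks_side G e Y z : size Y = size G -> (0 < size G)%N ->
  e.1 != size G -> last_blocks (rcons G e) (rcons Y z) = [:: z].
Proof.
move=> YG G0 e1; rewrite last_blocks_split ?size_rcons ?YG //.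
have qE : qseq (rcons G e) = [:: (size G).+1].
  by rewrite qseq_rcons // (negbTE e1).
rewrite /init_blocks /last_block qE /=; congr cons; apply/funext => w.
by rewrite size_rcons /block /= big_geq // mul1r.
Qed.

Variable P : probability Omega R.

Lemma last_blocks_unit e y : last_blocks [:: e] [:: y] = [:: y].
Proof.
rewrite last_blocksE qseq_unit /=; congr [:: _]; apply/funext => w.
by rewrite /block /= big_nat1.
Qed.

(** * Factorization of the nested expectation *)

Lemma EG_rec_fuel n G Y : (0 < size G <= n)%N -> EG_rec P n G Y = EG P G Y.
Proof.
elim/ltn_ind: n G Y => n IH G Y Gn.
case: n IH Gn => [|n] IH Gn; first lia.
rewrite /EG; case sG: (size G) => [|s]; first by rewrite sG in Gn.
have /andP[q0 qG] := qzero_bounds (G := G) ltac:(lia).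
rewrite /=; case: eqP => // q1; congr (_ * _).
have sT : size (take (qzero G).-1 G) = (qzero G).-1.
  by rewrite size_take_min; lia.
by rewrite !IH ?sT //; lia.
Qed.

Definition head_factor G Y : R :=
  if qzero G == 1%N then 1 else EG P (take (qzero G).-1 G) (take (qzero G).-1 Y).

Lemma EGE G Y : (0 < size G)%N ->
  EG P G Y = head_factor G Y * Dstar P (last_blocks G Y).
Proof.
move=> G0; have /andP[q0 qG] := qzero_bounds G0.
rewrite /EG /head_factor; case sG: (size G) => [|s]; first lia.
rewrite /=; case: eqP => [_|q1]; first by rewrite mul1r.
by congr (_ * _); rewrite EG_rec_fuel // size_take_min; lia.
Qed.

Lemma head_factor_rcons G Y y : (size G <= (size Y).+1)%N -> (0 < size G)%N ->
  head_factor G (rcons Y y) = head_factor G Y.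
Proof.
move=> GY G0; have /andP[q0 qG] := qzero_bounds G0.
rewrite /head_factor; case: ifP => // _; congr EG.
by rewrite -cats1 takel_cat //; lia.
Qed.

Lemma head_factor_new G e Y : (0 < size G)%N -> e.1 = size G ->
  head_factor (rcons G e) Y = head_factor G Y.
Proof.
move=> G0 e1; have /andP[q0 qG] := qzero_bounds G0.
rewrite /head_factor qzero_rcons // e1 eqxx; case: ifP => // _.
by rewrite -[rcons G e]cats1 takel_cat //; lia.
Qed.

Lemma EG_side G e Y z : size Y = size G -> (0 < size G)%N -> e.1 != size G ->
  EG P (rcons G e) (rcons Y z) = EG P G Y * Ex P z.
Proof.
move=> YG G0 e1; rewrite EGE ?size_rcons // last_blocks_side //=.
congr (_ * _); rewrite /head_factor qzero_rcons // (negbTE e1).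
have -> : ((size G).+1 == 1)%N = false by lia.
by rewrite -YG -!cats1 -pred_Sn take_size_cat // YG take_size_cat.
Qed.

End LastBlocks.

(** * Linearity of the nested expectations *)

Section Expectation.
Context {disp : measure_display} {Omega : measurableType disp} {R : realType}.
Variable P : probability Omega R.
Implicit Types (y z : Omega -> R) (A : seq (Omega -> R)) (c : R).

Lemma ExE y : Ex P y = \int[P]_w y w.
Proof. by rewrite /Ex unlock. Qed.

Lemma finite_Ex_cst c : finite_Ex P (fun=> c).
Proof. exact: finite_measure_integrable_cst. Qed.

Lemma finite_ExD y z : finite_Ex P y -> finite_Ex P z ->
  finite_Ex P (fun w => y w + z w).
Proof. by move=> fy fz; exact: (integrableD measurableT fy fz). Qed.

Lemma finite_ExZ c y : finite_Ex P y -> finite_Ex P (fun w => c * y w).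
Proof. by move=> fy; exact: (integrableZl measurableT c fy). Qed.

Lemma finite_Ex_lin c y z : finite_Ex P y -> finite_Ex P z ->
  finite_Ex P (fun w => y w + c * z w).
Proof. by move=> fy fz; apply: finite_ExD => //; exact: finite_ExZ. Qed.

Lemma finite_Ex_sum (I : eqType) (s : seq I) (F : I -> Omega -> R) :
  (forall i, i \in s -> finite_Ex P (F i)) ->
  finite_Ex P (fun w => \sum_(i <- s) F i w).
Proof.
elim: s => [|i s IH] sF.
  rewrite (_ : (fun _ => _) = fun=> 0); first exact: finite_Ex_cst.
  by apply/funext => w; rewrite big_nil.
rewrite (_ : (fun _ => _) = fun w => F i w + \sum_(j <- s) F j w).
  apply: finite_ExD; first by apply: sF; rewrite mem_head.
  by apply: IH => j js; apply: sF; rewrite inE js orbT.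
by apply/funext => w; rewrite big_cons.
Qed.

Lemma Ex_cst c : Ex P (fun=> c) = c.
Proof. by rewrite /Ex (expectation_cst P c). Qed.

Lemma Ex_lin c y z : finite_Ex P y -> finite_Ex P z ->
  Ex P (fun w => y w + c * z w) = Ex P y + c * Ex P z.
Proof.
move=> fy fz; rewrite !ExE RintegralD //; last exact: finite_ExZ.
by rewrite RintegralZl.
Qed.

Lemma ExZ c y : finite_Ex P y -> Ex P (fun w => c * y w) = c * Ex P y.
Proof. by move=> fy; rewrite !ExE RintegralZl. Qed.

Lemma ExD y z : finite_Ex P y -> finite_Ex P z ->
  Ex P (fun w => y w + z w) = Ex P y + Ex P z.
Proof. by move=> fy fz; rewrite !ExE RintegralD. Qed.

Lemma Ex_sum (I : eqType) (s : seq I) (F : I -> Omega -> R) :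
  (forall i, i \in s -> finite_Ex P (F i)) ->
  Ex P (fun w => \sum_(i <- s) F i w) = \sum_(i <- s) Ex P (F i).
Proof.
elim: s => [|i s IH] sF.
  rewrite big_nil (_ : (fun _ => _) = fun=> 0) ?Ex_cst //.
  by apply/funext => w; rewrite big_nil.
rewrite (_ : (fun _ => _) = fun w => F i w + \sum_(j <- s) F j w); last first.
  by apply/funext => w; rewrite big_cons.
have sF' j : j \in s -> finite_Ex P (F j).
  by move=> js; apply: sF; rewrite inE js orbT.
rewrite ExD ?IH ?big_cons //; first by apply: sF; rewrite mem_head.
exact: finite_Ex_sum.
Qed.

Lemma Dop_cons a A z : Dop P (a :: rcons A z) =
  fun w => a w * Dop P (rcons A z) w - Ex P (fun w => a w * Dop P (rcons A z) w).
Proof. by case: A. Qed.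

Lemma Dstar_cons a A z : Dstar P (a :: rcons A z) =
  Ex P (fun w => a w * Dop P (rcons A z) w).
Proof. by case: A. Qed.

Lemma finite_Dstar_cons a A z : finite_Dstar P (a :: rcons A z) <->
  finite_Ex P (fun w => a w * Dop P (rcons A z) w) /\ finite_Dstar P (rcons A z).
Proof. by case: A. Qed.

Lemma finite_Dstar1 z : finite_Dstar P [:: z] = finite_Ex P z.
Proof. by []. Qed.

Lemma Dop_lin c A y z :
  finite_Dstar P (rcons A y) -> finite_Dstar P (rcons A z) ->
  finite_Dstar P (rcons A (fun w => y w + c * z w)) /\
  Dop P (rcons A (fun w => y w + c * z w)) =
    fun w => Dop P (rcons A y) w + c * Dop P (rcons A z) w.
Proof.
elim: A => [|a A IH]; rewrite ?rcons_cons.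
  rewrite !finite_Dstar1 => fy fz; split; first exact: finite_Ex_lin.
  by apply/funext => w /=; rewrite Ex_lin //; ring.
move=> /finite_Dstar_cons[fay fy] /finite_Dstar_cons[faz fz].
have [fyz DE] := IH fy fz.
have aE : (fun w => a w * Dop P (rcons A (fun w => y w + c * z w)) w) =
    fun w => a w * Dop P (rcons A y) w + c * (a w * Dop P (rcons A z) w).
  by apply/funext => w; rewrite DE; ring.
split; first by apply/finite_Dstar_cons; split=> //; rewrite aE; exact:
  finite_Ex_lin.
by rewrite !Dop_cons aE Ex_lin //; apply/funext => w; rewrite DE; ring.
Qed.

Lemma finite_Dstar_lin c A y z :
  finite_Dstar P (rcons A y) -> finite_Dstar P (rcons A z) ->
  finite_Dstar P (rcons A (fun w => y w + c * z w)).
Proof. by move=> fy fz; case: (Dop_lin c fy fz). Qed.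

Lemma Dstar_lin c A y z :
  finite_Dstar P (rcons A y) -> finite_Dstar P (rcons A z) ->
  Dstar P (rcons A (fun w => y w + c * z w)) =
  Dstar P (rcons A y) + c * Dstar P (rcons A z).
Proof.
case: A => [|a A]; rewrite ?rcons_cons; first exact: Ex_lin.
move=> /finite_Dstar_cons[fay fy] /finite_Dstar_cons[faz fz].
rewrite !Dstar_cons -Ex_lin //; congr Ex; apply/funext => w.
by rewrite (Dop_lin c fy fz).2; ring.
Qed.

Lemma Dop_cst c A : Dop P (rcons A (fun=> c)) = fun=> 0.
Proof.
elim: A => [|a A IH]; rewrite ?rcons_cons; first by apply/funext => w /=;
  rewrite Ex_cst subrr.
rewrite Dop_cons IH; apply/funext => w.
rewrite (_ : (fun _ => _) = fun=> 0) ?Ex_cst ?mulr0 ?subrr //.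
by apply/funext => w'; rewrite mulr0.
Qed.

Lemma finite_Dstar_cst c A : finite_Dstar P (rcons A (fun=> c)).
Proof.
elim: A => [|a A IH]; rewrite ?rcons_cons; first exact: finite_Ex_cst.
apply/finite_Dstar_cons; split=> //; rewrite Dop_cst.
rewrite (_ : (fun _ => _) = fun=> 0); first exact: finite_Ex_cst.
by apply/funext => w'; rewrite mulr0.
Qed.

(** The innermost operator centers its argument and annihilates constants. With a single argument
    [Dstar] is a plain expectation, whence the condition on [A]. *)
Lemma Dstar_cst c A : A != [::] -> Dstar P (rcons A (fun=> c)) = 0.
Proof.
case: A => // a A _; rewrite rcons_cons Dstar_cons Dop_cst.
rewrite (_ : (fun _ => _) = fun=> 0) ?Ex_cst //.
by apply/funext => w'; rewrite mulr0.
Qed.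

Lemma finite_Dstar_sum (I : eqType) (s : seq I) A (F : I -> Omega -> R) :
  (forall i, i \in s -> finite_Dstar P (rcons A (F i))) ->
  finite_Dstar P (rcons A (fun w => \sum_(i <- s) F i w)) /\
  (Dstar P (rcons A (fun w => \sum_(i <- s) F i w)) =
    \sum_(i <- s) Dstar P (rcons A (F i))).
Proof.
elim: s => [|i s IH] sF.
  rewrite big_nil (_ : (fun _ => _) = fun=> 0); last first.
    by apply/funext => w; rewrite big_nil.
  split; first exact: finite_Dstar_cst.
  case: A {sF} => [|a A]; first exact: Ex_cst.
  exact: Dstar_cst.
rewrite (_ : (fun _ => _) = fun w => (\sum_(j <- s) F j w) + 1 * F i w); last first.
  by apply/funext => w; rewrite big_cons mul1r addrC.
have fi : finite_Dstar P (rcons A (F i)) by apply: sF; rewrite mem_head.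
have [j js|fs Ds] := IH; first by apply: sF; rewrite inE js orbT.
split; first exact: finite_Dstar_lin.
by rewrite Dstar_lin // Ds mul1r big_cons addrC.
Qed.

Lemma Dstar0 A : Dstar P (rcons A (fun=> 0)) = 0.
Proof. by case: A => [|a A]; [exact: Ex_cst | exact: Dstar_cst]. Qed.

Lemma finite_DstarZ c A z : finite_Dstar P (rcons A z) ->
  finite_Dstar P (rcons A (fun w => c * z w)) /\
  Dstar P (rcons A (fun w => c * z w)) = c * Dstar P (rcons A z).
Proof.
move=> fz; have -> : (fun w => c * z w) = fun w => (fun=> 0) w + c * z w.
  by apply/funext => w; rewrite add0r.
have f0 := finite_Dstar_cst 0 A.
by split; [exact: finite_Dstar_lin | rewrite Dstar_lin // Dstar0 add0r].
Qed.

(* Splitting off the last argument recentres it: [D(.., b, z)] is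
   [D(.., b (z - E z))]. *)
Lemma Dop_split A b z : Dop P (rcons (rcons A b) z) =
  Dop P (rcons A (fun w => b w * (z w - Ex P z))).
Proof.
by elim: A => [//|a A IH]; rewrite !rcons_cons !Dop_cons IH.
Qed.

Lemma Dstar_split A b z : Dstar P (rcons (rcons A b) z) =
  Dstar P (rcons A (fun w => b w * (z w - Ex P z))).
Proof. by case: A => [//|a A]; rewrite !rcons_cons !Dstar_cons Dop_split. Qed.

Lemma finite_Dstar_split A b z : finite_Dstar P (rcons (rcons A b) z) <->
  finite_Dstar P (rcons A (fun w => b w * (z w - Ex P z))) /\ finite_Ex P z.
Proof.
elim: A => [//|a A IH]; rewrite !rcons_cons; split.
  move=> /finite_Dstar_cons[h1 /IH[h2 h3]]; split=> //.
  by apply/finite_Dstar_cons; rewrite -Dop_split.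
move=> [/finite_Dstar_cons[h1 h2] h3]; apply/finite_Dstar_cons.
by split; [rewrite Dop_split | apply/IH].
Qed.

Lemma finite_Dstar_last A z : finite_Dstar P (rcons A z) -> finite_Ex P z.
Proof. by elim: A => [//|a A IH]; rewrite rcons_cons => /finite_Dstar_cons[_
  /IH]. Qed.

(** From b z = b (z - E z) + (E z) b and linearity in the last argument. The three terms show z
    merged into an argument, as an argument of its own, and split off as a factor; these are the
    three ways in which a new vertex can enter [EG]. *)
Lemma Dstar_merge A b z : finite_Dstar P (rcons A b) ->
  finite_Dstar P (rcons (rcons A b) z) ->
  finite_Dstar P (rcons A (fun w => b w * z w)) /\
  Dstar P (rcons A (fun w => b w * z w)) =
  Dstar P (rcons (rcons A b) z) + Dstar P (rcons A b) * Ex P z.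
Proof.
move=> fb /finite_Dstar_split[fbz fz].
have zE : (fun w => b w * z w) =
    fun w => b w * (z w - Ex P z) + Ex P z * b w.
  by apply/funext => w; ring.
rewrite zE; split; first exact: finite_Dstar_lin.
by rewrite Dstar_lin // Dstar_split [_ * Ex P z]mulrC.
Qed.

End Expectation.

(** * Products of the summands *)

(** With M the largest of 1 and the |x_i|, the product is at most M^N, and M^N is one of the terms
    on the right. Moments of order N thus control all mixed products of degree at most N. *)
Lemma prod_norm_le (R : realType) (I : eqType) (x : I -> R) (l : seq I) N :
  (size l <= N)%N ->
  `|\prod_(i <- l) x i| <= 1 + \sum_(i <- l) `|x i| ^+ N.
Proof.
move=> lN; pose M := \big[Num.max/1]_(i <- l) `|x i|.
have M1 : 1 <= M.
  by rewrite /M; elim: (l) => [|i s IH]; rewrite ?big_nil ?big_cons // le_max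
    IH orbT.
have xM i : i \in l -> `|x i| <= M.
  rewrite /M; elim: (l) => // j s IH; rewrite inE big_cons le_max =>
    /predU1P[->|/IH ->].
    by rewrite lexx.
  by rewrite orbT.
have PM : `|\prod_(i <- l) x i| <= M ^+ size l.
  elim: (l) xM => [|j s IH] sM; first by rewrite big_nil normr1.
  rewrite big_cons normrM exprS; apply: ler_pM => //; first by rewrite sM ?mem_head.
  by apply: IH => i si; rewrite sM // inE si orbT.
apply: (le_trans PM); apply: (@le_trans _ _ (M ^+ N)).
  exact: ler_weXn2l.
rewrite /M; elim: (l) => [|i s IH]; first by rewrite !big_nil expr1n addr0.
rewrite !big_cons; set a := `|x i|; set b := \big[_/_]_(_ <- _) _ in IH *.
have a0 : 0 <= a ^+ N by rewrite exprn_ge0 // normr_ge0.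
have b0 : 0 <= \sum_(j <- s) `|x j| ^+ N.
  by apply: sumr_ge0 => j _; rewrite exprn_ge0.
have [_|_] := leP a b; first by rewrite (le_trans IH) //; lra.
lra.
Qed.

Section ProductsOfX.
Context {disp : measure_display} {Omega : measurableType disp} {R : realType}.
Variables (P : probability Omega R) (I : choiceType) (X : I -> {RV P >-> R}).
Variables (T : {pred I}) (N : nat).
Hypothesis X_moment : forall i, i \in T ->
  ('E_P[fun w => (`|X i w| ^+ N)%R] < +oo)%E.

Definition prodX (l : seq I) : Omega -> R := fun w => \prod_(i <- l) X i w.

Lemma measurable_prodX l : measurable_fun setT (prodX l).
Proof.
by apply: measurable_prod => i _; exact: measurable_funPT.
Qed.

Lemma finite_Ex_normX i : i \in T -> finite_Ex P (fun w => `|X i w| ^+ N).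
Proof.
move=> iT; apply/integrableP; split.
  apply/measurable_EFinP; apply: measurable_funX.
  by apply: measurableT_comp => //; exact: measurable_funPT.
have := X_moment iT; rewrite unlock; under eq_integral => w _.
  rewrite -[_%:E]gee0_abs ?lee_fin ?exprn_ge0 //.
  over.
by [].
Qed.

Lemma finite_Ex_prodX l : (size l <= N)%N -> all T l -> finite_Ex P (prodX l).
Proof.
move=> lN lT; have mX := measurable_prodX l.
apply: (@le_integrable _ _ _ _ _ measurableT _
   (EFin \o (fun w => 1 + \sum_(i <- l) `|X i w| ^+ N))).
- exact/measurable_EFinP.
- move=> w _; rewrite lee_fin (le_trans (prod_norm_le _ lN)) //.
  exact: ler_norm.
apply: finite_ExD; first exact: finite_Ex_cst.
apply: finite_Ex_sum => i il; apply: finite_Ex_normX.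
exact: (allP lT).
Qed.

Definition total_size (ls : seq (seq I)) : nat := sumn (map size ls).

(** The second conclusion makes the induction work: a product in front is absorbed by the first
    argument, and the centering constant leaves that product alone. The total degree never exceeds
    N. *)
Lemma finite_Dop_prodX ls : ls != [::] -> (total_size ls <= N)%N -> all (all T)
  ls ->
  finite_Dstar P (map prodX ls) /\
  (forall l, (size l + total_size ls <= N)%N -> all T l ->
     finite_Ex P (fun w => prodX l w * Dop P (map prodX ls) w)).
Proof.
have prodX_cat l l' : prodX (l ++ l') = fun w => prodX l w * prodX l' w.
  by apply/funext => w; rewrite /prodX big_cat.
elim: ls => // l ls IH _; rewrite /total_size /= -/(total_size ls) => lN
  /andP[lT lsT].
case: ls IH lN lsT => [|l1 ls] IH lN lsT.
  rewrite /total_size /= addn0 in lN; split; first exact: finite_Ex_prodX.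
  move=> l' l'N l'T; rewrite (_ : (fun _ => _) =
    fun w => prodX (l' ++ l) w + (- Ex P (prodX l)) * prodX l' w); last first.
    by apply/funext => w; rewrite prodX_cat /=; ring.
  apply: finite_Ex_lin; apply: finite_Ex_prodX => //; rewrite ?size_cat
    ?all_cat ?l'T //.
    by rewrite /total_size /= addn0 in l'N.
  by move: l'N; rewrite /total_size /=; lia.
have [fD fL] := IH isT ltac:(lia) lsT.
have fl := fL l lN lT.
rewrite map_cons; move: fD fL fl; rewrite [map prodX (l1 :: ls)]/=.
set Y' := _ :: _ => fD fL fl.
split; first by split.
move=> l' l'N l'T.
rewrite (_ : (fun _ => _) = fun w => prodX (l' ++ l) w * Dop P Y' w +
    (- Ex P (fun w => prodX l w * Dop P Y' w)) * prodX l' w); last first.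
  by apply/funext => w; rewrite prodX_cat /=; ring.
apply: finite_Ex_lin.
  apply: fL; last by rewrite all_cat l'T.
  by move: l'N; rewrite size_cat /total_size /=; lia.
by apply: finite_Ex_prodX => //; move: l'N; rewrite /total_size /=; lia.
Qed.

Lemma last_blocks_prodX (G : genogram) jj : (0 < size G)%N -> size jj = size G ->
  exists ls, [/\ ls != [::], total_size ls = size (flatten ls),
    last_blocks G [seq (X i : Omega -> R) | i <- jj] = map prodX ls,
    (total_size ls <= size jj)%N & {subset flatten ls <= jj}].
Proof.
have prodX1 i : prodX [:: i] = X i by apply/funext => w; rewrite /prodX big_seq1.
elim/last_ind: G jj => // G e IH jj _; rewrite size_rcons.
case/lastP: jj => // jj x; rewrite size_rcons => -[sj]; rewrite map_rcons.
have sz ls : total_size ls = size (flatten ls) by rewrite size_flatten.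
have [G0|G0] := posnP (size G).
  have {}jj0 : jj = [::] by apply/nilP; rewrite /nilp sj G0.
  move: G0 => /size0nil ->; rewrite jj0; exists [:: [:: x]]; split=> //.
  by rewrite /= prodX1 last_blocks_unit.
have [e1|e1] := boolP (e.1 == size G); last first.
  exists [:: [:: x]]; split => //=; last by move=> i; rewrite mem_rcons !inE => ->.
    by rewrite last_blocks_side ?size_map // prodX1.
have [ls [ls0 _ lsE lsN lsj]] := IH jj G0 sj.
have [e2|e2] := lerP 0 e.2.
  exists (rcons ls [:: x]); split => //.
  - by case: (ls).
  - by rewrite last_blocks_nonneg ?size_map // ?(eqP e1) // lsE map_rcons prodX1.
  - by rewrite sz flatten_rcons size_cat addn1 -sz ltnS.
  - move=> i; rewrite flatten_rcons mem_cat mem_rcons !inE orbC.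
    by move=> /orP[->//|/lsj ->]; rewrite orbT.
case/lastP: jj sj IH lsE lsN lsj => [|jj y] sj IH lsE lsN lsj.
  by rewrite -sj in G0.
case/lastP: ls ls0 lsE lsN lsj => // ls l _ lsE lsN lsj.
have sj' : (size [seq (X i : Omega -> R) | i <- jj]).+1 = size G.
  by rewrite size_map -sj size_rcons.
exists (rcons ls (rcons l x)); split => //.
- by case: (ls).
- rewrite map_rcons last_blocks_neg ?(eqP e1) // map_rcons.
  move: lsE; rewrite map_rcons last_blocks_split // map_rcons => /rcons_inj[-> lE].
  congr rcons; apply/funext => w.
  rewrite mulrA -[_ * X y w]/((fun w => last_block G _ w * X y w) w) lE.
  by rewrite /prodX -cats1 big_cat big_seq1.
- rewrite !sz !flatten_rcons !size_cat !size_rcons in lsN *; lia.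
move=> i; rewrite flatten_rcons mem_cat !mem_rcons !inE => /or3P[h|->//|h].
  by have := lsj i; rewrite flatten_rcons mem_cat h mem_rcons inE => ->;
    rewrite ?orbT.
by have := lsj i; rewrite flatten_rcons mem_cat h orbT mem_rcons inE => ->;
  rewrite ?orbT.
Qed.

Lemma finite_Dstar_blocks (G : genogram) jj : (0 < size G)%N -> size jj = size G ->
  (size G <= N)%N -> all T jj ->
  finite_Dstar P (last_blocks G [seq (X i : Omega -> R) | i <- jj]).
Proof.
move=> G0 sj GN jT; have [ls [ls0 _ -> lsN lsj]] := last_blocks_prodX G0 sj.
apply: (finite_Dop_prodX ls0 _ _).1; first by rewrite (leq_trans lsN) ?sj.
apply/allP => l ls_l; apply/allP => i li; apply: (allP jT); apply: lsj.
by apply/flattenP; exists l.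
Qed.

End ProductsOfX.

(** * Taylor remainder *)

Section Taylor.
Variable R : realType.
Local Notation mu := (@lebesgue_measure R).
Implicit Types (f g F h : R -> R).

Lemma continuous_mul f g : continuous f -> continuous g ->
  continuous (fun v => f v * g v).
Proof. by move=> cf cg x; exact: (continuousM (cf x) (cg x)). Qed.

Lemma continuous_add f g : continuous f -> continuous g ->
  continuous (fun v => f v + g v).
Proof. by move=> cf cg x; exact: (continuousD (cf x) (cg x)). Qed.

Lemma continuous_cst (c : R) : continuous (fun _ : R => c).
Proof. by move=> x; exact: cst_continuous. Qed.

Lemma integrable01 f : continuous f ->
  mu.-integrable `[0, 1] (EFin \o f).
Proof.
move=> cf; apply: continuous_compact_integrable; first exact: segment_compact.
exact: continuous_subspaceT.
Qed.

Lemma integral01_derive F f : (forall x : R, is_derive x 1 F (f x)) ->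
  continuous f -> \int[mu]_(v in `[0, 1]) f v = F 1 - F 0.
Proof.
move=> dF cf; have cF : continuous F.
  move=> x; apply: differentiable_continuous; apply/derivable1_diffP.
  by have [] := dF x.
rewrite /Rintegral (@continuous_FTC2 _ f F) //.
- exact: continuous_subspaceT.
- split.
  + by move=> x _; have [] := dF x.
  + exact: cvg_at_right_filter (cF _).
  + exact: cvg_at_left_filter (cF _).
- by move=> x _; rewrite derive1E; have [_ ->] := dF x.
Qed.

(** Integrate the derivative of v^n (h(seg v) - h(a)) over [0, 1], where seg v = v a + (1 - v) b.
    The function vanishes at v = 1, and at v = 0 as well if n > 0; for n = 0 its value at 0 is h(b)
    - h(a). With n = k - u(k) this treats both forms of [Delta] at once. *)
Lemma taylor_remainder h (h' : R -> R) (a b : R) n :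
  (forall x : R, is_derive x 1 h (h' x)) -> continuous h' ->
  (if n == 0%N then h b - h a else
   \int[mu]_(v in `[0, 1])
      (n%:R * v ^+ n.-1 * (h (v * a + (1 - v) * b) - h a))) =
  (b - a) / n.+1%:R * (h' a +
   \int[mu]_(v in `[0, 1])
      (n.+1%:R * v ^+ n * (h' (v * a + (1 - v) * b) - h' a))).
Proof.
move=> dh ch'; pose seg (v : R) := v * a + (1 - v) * b.
have dseg (v : R) : is_derive v 1 seg (a - b).
  have -> : seg = (id : R -> R) * cst (a - b) + cst b.
    by apply/funext => x; rewrite !fctE /seg /=; ring.
  apply: is_derive_eq.
  by rewrite /GRing.scale /=; ring.
have cseg : continuous seg.
  move=> x; apply: differentiable_continuous; apply/derivable1_diffP.
  by have [] := dseg x.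
have dhs (v : R) : is_derive v 1 (h \o seg) (h' (seg v) * (a - b)) by exact:
  is_derive1_comp.
have chs : continuous (h \o seg).
  move=> x; apply: differentiable_continuous; apply/derivable1_diffP.
  by have [] := dhs x.
have ch's : continuous (h' \o seg).
  by move=> x; apply: continuous_comp; [exact: cseg | exact: ch'].
have cX k : continuous (fun v : R => v ^+ k) by move=> x; exact: exprn_continuous.
pose J := \int[mu]_(v in `[0, 1]) (v ^+ n * h' (seg v)).
have cJ : continuous (fun v : R => v ^+ n * h' (seg v)) by exact: continuous_mul.
have cXn : continuous (fun v : R => n.+1%:R * v ^+ n).
  by apply: continuous_mul => //; exact: continuous_cst.
(* The weight (n + 1) v^n has integral 1, so the subtracted constant h'(a) cancels the summand h'(a)
   in front of the integral. *)
have JE : \int[mu]_(v in `[0, 1]) (n.+1%:R * v ^+ n * (h' (seg v) - h' a)) =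
    n.+1%:R * J - h' a.
  have -> : \int[mu]_(v in `[0, 1]) (n.+1%:R * v ^+ n * (h' (seg v) - h' a)) =
      \int[mu]_(v in `[0, 1]) (n.+1%:R * (v ^+ n * h' (seg v)) - h' a *
        (n.+1%:R * v ^+ n)).
    by apply: eq_Rintegral => v _; ring.
  rewrite RintegralB //; first last.
  - by apply: integrable01; apply: continuous_mul => //; exact: continuous_cst.
  - by apply: integrable01; apply: continuous_mul => //; exact: continuous_cst.
  rewrite RintegralZl //; last exact: integrable01.
  rewrite RintegralZl //; last exact: integrable01.
  have dX (x : R) : is_derive x 1 ((id : R -> R) ^+ n.+1) (n.+1%:R * x ^+ n).
    by apply: is_derive_eq; rewrite /GRing.scale /= mulr1.
  by rewrite (integral01_derive dX cXn) !fctE /= expr1n exprS mul0r subr0 mulr1.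
have -> : (b - a) / n.+1%:R * (h' a + \int[mu]_(v in `[0, 1])
      (n.+1%:R * v ^+ n * (h' (v * a + (1 - v) * b) - h' a))) = (b - a) * J.
  have n0 : n.+1%:R != 0 :> R by rewrite pnatr_eq0.
  by rewrite JE; field.
have dF (v : R) : is_derive v 1 (fun v : R => v ^+ n * (h (seg v) - h a))
    (n%:R * v ^+ n.-1 * (h (seg v) - h a) + (a - b) * (v ^+ n * h' (seg v))).
  have -> : (fun v : R => v ^+ n * (h (seg v) - h a)) =
      (id : R -> R) ^+ n * ((h \o seg) - cst (h a)).
    by apply/funext => x; rewrite !fctE.
  apply: is_derive_eq.
  by rewrite /GRing.scale /= !fctE; ring.
have cL : continuous (fun v : R => n%:R * v ^+ n.-1 * (h (seg v) - h a)).
  apply: continuous_mul; last by apply: continuous_add => //; exact: continuous_cst.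
  by apply: continuous_mul => //; exact: continuous_cst.
have cR : continuous (fun v : R => (a - b) * (v ^+ n * h' (seg v))).
  by apply: continuous_mul => //; exact: continuous_cst.
have := integral01_derive dF.
have cD : continuous (fun v : R => n%:R * v ^+ n.-1 * (h (seg v) - h a) +
    (a - b) * (v ^+ n * h' (seg v))).
  exact: continuous_add.
move=> /(_ cD); rewrite RintegralD //; [|exact: integrable01|exact: integrable01].
rewrite RintegralZl //; last exact: integrable01.
rewrite -/J expr1n expr0n /seg !mul1r subrr mul0r addr0 subrr mul0r add0r subr0
  mul1r.
case: eqP => [n0|n0].
  have -> : \int[mu]_(v in `[0, 1]) (n%:R * v ^+ n.-1 * (h (v * a + (1 - v) *
    b) - h a)) = 0.
    rewrite n0; under eq_Rintegral do rewrite !mul0r.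
    by rewrite Rintegral_cst // mul0r.
  rewrite !add0r /= mul1r => e; apply: oppr_inj.
  by rewrite -mulNr !opprB in e *; rewrite e.
rewrite /= !mul0r oppr0 => e; rewrite -(opprB a b) mulNr.
by apply/eqP; rewrite -subr_eq0 opprK; apply/eqP.
Qed.

End Taylor.

(** * Moments and cumulants *)

Section FormalLog.
Variable R : numFieldType.
Implicit Types M p q : {poly R}.

Lemma coef_expn_lt M r n : M`_0 = 0 -> (n < r)%N -> (M ^+ r)`_n = 0.
Proof.
move=> M0; elim: r n => // r IH n nr; rewrite exprS coefM big_ord_recl M0 mul0r
  add0r.
rewrite big1 // => i _; rewrite IH ?mulr0 //.
by have := ltn_ord i; rewrite lift0; lia.
Qed.

Lemma coef_expn_eq p q r n : (forall i, (i <= n)%N -> p`_i = q`_i) ->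
  (p ^+ r)`_n = (q ^+ r)`_n.
Proof.
elim: r n => [//|r IH] n pq; rewrite !exprS !coefM; apply: eq_bigr => i _.
by rewrite pq ?(IH (n - i)%N) //; [move=> l li; rewrite pq //; lia | rewrite -ltnS].
Qed.

Definition formal_log N M : {poly R} :=
  \sum_(1 <= r < N.+1) ((-1) ^+ r.-1 / r%:R) *: M ^+ r.

(** This is (1 + M) (log (1 + M))' = M' up to truncation; the error is the tail of the geometric sum
    in -M. *)
Lemma deriv_formal_log N M :
  (1 + M) * (formal_log N M)^`() = M^`() - (- M) ^+ N * M^`().
Proof.
elim: N => [|N IH].
  by rewrite /formal_log big_geq // deriv0 mulr0 expr0 mul1r subrr.
rewrite /formal_log big_nat_recr //= -/(formal_log N M) derivD mulrDr IH derivZ.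
rewrite deriv_exp /= -scalerMnr scalerMnl -mulr_natr divfK ?pnatr_eq0 // exprS.
have -> : (-1) ^+ N *: (M^`() * M ^+ N) = (- M) ^+ N * M^`().
  by rewrite -[- M]scaleN1r exprZn -scalerAl mulrC.
ring.
Qed.

(** As M has no constant term, the truncation error contains only powers of degree at least N and is
    invisible in the coefficient of degree n. *)
Lemma formal_log_coef N M n : M`_0 = 0 -> (n < N)%N ->
  M^`()`_n = \sum_(i < n.+1) (1 + M)`_(n - i) * (formal_log N M)^`()`_i.
Proof.
move=> M0 nN; have /(congr1 (fun p : {poly R} => p`_n)) := deriv_formal_log N M.
rewrite coefMr coefB => ->; rewrite [X in _ - X]coefM big1 ?subr0 // => i _.
rewrite coef_expn_lt ?mul0r ?coefN ?M0 ?oppr0 //.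
by have := ltn_ord i; lia.
Qed.

End FormalLog.

Section Cumulants.
Context {disp : measure_display} {Omega : measurableType disp} {R : realType}.
Variable P : probability Omega R.

Lemma moment0 (Z : Omega -> R) : moment P 0 Z = 1.
Proof. by rewrite /moment; under eq_fun do rewrite expr0; rewrite Ex_cst. Qed.

Lemma mgf_truncE N Z i : (mgf_trunc P N Z)`_i =
  if (i < N.+1)%N then (if i == 0%N then 0 else moment P i Z / i`!%:R) else 0.
Proof. by rewrite /mgf_trunc coef_poly. Qed.

(** Each cumulant truncates at its own order. A common order N for all of them is needed to compare
    coefficients within a single polynomial. *)
Lemma cumulantE N n (Z : Omega -> R) : (0 < n <= N)%N ->
  cumulant P n Z / n`!%:R = (formal_log N (mgf_trunc P N Z))`_n.
Proof.
move=> nN; have fn : n`!%:R != 0 :> R by rewrite pnatr_eq0 -lt0n fact_gt0.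
rewrite /cumulant mulrC mulKf // /formal_log coef_sum.
rewrite [RHS](big_cat_nat (n := n.+1)) //=; try lia.
rewrite [X in _ = _ + X]big_nat_cond [X in _ = _ + X]big1 ?addr0.
  apply: eq_bigr => r _; rewrite coefZ; congr (_ * _).
  by apply: coef_expn_eq => i ni; rewrite !mgf_truncE !ltnS ni (leq_trans ni)
    //; lia.
move=> r /andP[rn _]; rewrite coefZ coef_expn_lt ?mulr0 //; last lia.
by rewrite mgf_truncE.
Qed.

(** Coefficient n of M' = (1 + M) (log (1 + M))'. The binomial coefficient is written as a falling
    factorial over i!, so that the last factor is the expected i-th derivative of x^n at Z, as in
    the expansion for a monomial. *)
Lemma moment_cumulant n (Z : Omega -> R) :
  moment P n.+1 Z = \sum_(i < n.+1)
    cumulant P i.+1 Z / i`!%:R * ((n ^_ i)%:R * moment P (n - i) Z).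
Proof.
have M0 : (mgf_trunc P n.+1 Z)`_0 = 0 by rewrite mgf_truncE.
have := formal_log_coef M0 (ltnSn n).
have fn k : k`!%:R != 0 :> R by rewrite pnatr_eq0 -lt0n fact_gt0.
rewrite coef_deriv mgf_truncE ltnSn /= => h.
have -> : moment P n.+1 Z = n`!%:R * (moment P n.+1 Z / n.+1`!%:R *+ n.+1).
  rewrite factS natrM -[_ *+ n.+1]mulr_natr; have : n.+1%:R != 0 :> R by
    rewrite pnatr_eq0.
  move: (fn n); move: (n.+1%:R : R) (n`!%:R : R) => a c c0 a0.
  by field; rewrite c0 a0.
rewrite h big_distrr /=; apply: eq_bigr => i _; have := ltn_ord i => ni.
rewrite coef_deriv -(@cumulantE n.+1) //.
have -> : (1 + mgf_trunc P n.+1 Z)`_(n - i) = moment P (n - i) Z / (n - i)`!%:R.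
  rewrite coefD mgf_truncE ifT; last lia.
  case: eqP => [->|ni0]; first by rewrite coef1 moment0 fact0 addr0 divr1.
  by rewrite coef1; case: eqP => // _; rewrite add0r.
have -> : (n ^_ i)%:R = n`!%:R / (n - i)`!%:R :> R.
  by rewrite -(@ffact_fact n i) // natrM mulfK.
rewrite factS natrM -[_ *+ i.+1]mulr_natr; have : i.+1%:R != 0 :> R by rewrite
  pnatr_eq0.
move: (fn i) (fn (n - i)%N).
move: (i.+1%:R : R) (i`!%:R : R) ((n - i)`!%:R : R) => a c c' c0 c'0 a0.
by field; rewrite c0 a0 c'0.
Qed.

End Cumulants.

(** * Increments over new vertices *)

Section Expansion.
Context {disp : measure_display} {Omega : measurableType disp} {R : realType}.
Variables (P : probability Omega R) (d m : nat) (prec : rel 'rV[int]_d).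
Variables (T : {fset 'rV[int]_d}) (X : 'rV[int]_d -> {RV P >-> R}).
Hypothesis prec_irr : irreflexive prec.
Implicit Types (G H : genogram) (e : nat * int) (ii jj : seq 'rV[int]_d)
  (f : R -> R) (J : {fset 'rV[int]_d}).

Local Notation S := (#|` T|).
Local Notation B := (Bset m prec T).
Local Notation D := (Dset m prec T).
Local Notation Wm := (Wminus T X).
Local Notation Dl := (Delta m prec T X).
Local Notation isig := (sigma T X)^-1.

Lemma Wminus_fset0 w : Wm fset0 w = W T X w.
Proof. by rewrite /Wminus fsetD0. Qed.

Lemma Wminus_full w : Wm T w = 0.
Proof. by rewrite /Wminus fsetDv big_seq_fset0 mulr0. Qed.

Lemma Wminus_sub J J' w : J `<=` J' -> J' `<=` T ->
  Wm J' w - Wm J w = - (isig * \sum_(i <- J' `\` J) X i w).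
Proof.
move=> JJ' J'T; rewrite /Wminus -mulrBr -mulrN; congr (_ * _).
rewrite [X in _ - X](big_fsetID _ (mem J')) /=.
rewrite (@eq_fbigl _ _ _ _ [fset x in T `\` J | x \in J'] (J' `\` J)) /=; last
  first.
  move=> i; rewrite !inE; have := fsubsetP J'T i.
  by case: (i \in J'); rewrite ?andbT ?andbF // => -> //; rewrite andbT.
rewrite (@eq_fbigl _ _ _ _ [fset x in T `\` J | x \notin J'] (T `\` J')) /=;
  last first.
  move=> i; rewrite !inE; have := fsubsetP JJ' i.
  by case: (i \in J'); case: (i \in J); rewrite ?andbT ?andbF // => /(_ isT).
by rewrite opprD addrCA subrr addr0.
Qed.

Definition new_points H p jj : {fset 'rV[int]_d} :=
  [fset nth 0 jj l.-1 | l in p :: ancestors H p].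

(* A new vertex with parent [p] and identifier [n >= 0] has
   [B = shell H p jj n.+1] and [D = shell H p jj n]. *)
Definition shell H p jj n : {fset 'rV[int]_d} :=
  (if n is n'.+1 then nbhds m prec T n' (new_points H p jj) else fset0)
  `|` D H jj p.

Lemma Delta_new H p s jj f w : is_genogram H -> (0 < p <= size H)%N ->
  Dl f (rcons H (p, s%:Z)) jj w =
  derive1n (size H).-1 f (Wm (shell H p jj s.+1) w) -
  derive1n (size H).-1 f (Wm (shell H p jj s) w).
Proof.
move=> gH pH; have tH := genogram_treelike gH.
set G := rcons H _; have sG : size G = (size H).+1 by rewrite size_rcons.
have tG : treelike G by apply: treelike_rcons => //=; lia.
have iG : ident G (size G) = s%:Z by rewrite sG ident_rcons_last.
have pG : parent G (size G) = p by rewrite sG parent_rcons_last.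
have aG : ancestor_points G jj (size G) = new_points H p jj.
  by rewrite /ancestor_points sG ancestors_rcons_last.
have DG : D G jj p = D H jj p by apply: Dset_rcons => //=; lia.
rewrite /Delta uidx_nonneg ?iG // eqxx.
have -> : (size G - 2 = (size H).-1)%N by rewrite sG; lia.
have pGs : (0 < parent G (size G) < size G)%N by rewrite pG sG; lia.
rewrite BsetE_nonneg ?iG // [Dset _ _ _ G jj (size G)]DsetE // iG.
rewrite aG pG DG /shell absz_nat.
by clear; case: s.
Qed.

Lemma Delta_telescope H p n jj f w : is_genogram H -> (0 < p <= size H)%N ->
  \sum_(s <- iota 0 n) Dl f (rcons H (p, s%:Z)) jj w =
  derive1n (size H).-1 f (Wm (shell H p jj n) w) -
  derive1n (size H).-1 f (Wm (D H jj p) w).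
Proof.
move=> gH pH; elim: n => [|n IH]; first by rewrite big_nil /shell fset0U subrr.
rewrite iota_rcons -cats1 big_cat big_seq1 IH Delta_new //.
by rewrite add0n /=; ring.
Qed.

Lemma Delta_path_sum H jj f w : is_genogram H ->
  \sum_(s <- iota 0 S.+1) Dl f (rcons H (size H, s%:Z)) jj w =
  derive1n (size H).-1 f 0 -
  derive1n (size H).-1 f (Wm (D H jj (size H)) w).
Proof.
move=> gH; have H0 := genogram_nonempty gH.
rewrite Delta_telescope //; last lia.
(* Index S + 1 of [shell] refers to the neighborhood of rank S = |T|. *)
have -> : shell H (size H) jj S.+1 = T.
  by rewrite /shell nbhds_full //; apply/fsetUidPl/Dset_sub => //; lia.
by rewrite Wminus_full.
Qed.

(** For s_j >= 1 the identifiers 0, ..., s_j - 1 of a sibling of v[j] telescope from D at the parent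
    to D_j, since D_j is built from rank s_j - 1. For s_j <= 0 there are no such siblings and D_j
    equals D at the parent. The chain ends at the root, where D is empty. *)
Lemma Delta_side_sum H jj f w : is_genogram H ->
  \sum_(e <- side_ext H (size H)) Dl f (rcons H e) jj w =
  derive1n (size H).-1 f (Wm (D H jj (size H)) w) -
  derive1n (size H).-1 f (W T X w).
Proof.
move=> gH; have H0 := genogram_nonempty gH; have tH := genogram_treelike gH.
suff claim j : (0 < j <= size H)%N ->
    \sum_(e <- side_ext H j) Dl f (rcons H e) jj w =
    derive1n (size H).-1 f (Wm (D H jj j) w) -
    derive1n (size H).-1 f (W T X w) by apply: claim; lia.
elim/ltn_ind: j => j IH jH.
have [j1|j1] := leqP j 1.
  have -> : j = 1%N by lia.
  have [p1 s1] := genogram_root gH.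
  rewrite /side_ext /lineage ancestors_nil //.
  rewrite /= s1 /= big_nil.
  by rewrite Dset1 Wminus_fset0 subrr.
have pj := genogram_tree gH (j := j) ltac:(lia).
rewrite side_extE // ?big_cat /=; last lia.
rewrite IH; try lia.
rewrite [D H jj j]DsetE //.
case: ifP => sj; last by rewrite big_nil add0r fset0U.
rewrite big_map Delta_telescope //; last lia.
have -> : shell H (parent H j) jj `|ident H j|%N =
    nbhds m prec T `|ident H j|.-1 (ancestor_points H jj j)
    `|` Dset m prec T H jj (parent H j).
  rewrite /shell /ancestor_points ancestorsE //; last lia.
  case E : `|ident H j|%N => [|n] //; first lia.
by rewrite addrA subrK.
Qed.

(** Identifier -1 leaves u, B and D as they are at the parent. Only the order grows, which raises
    the exponent and the derivative by one. *)
Lemma Delta_neg H ii x f w : is_genogram H -> (1 < size H)%N ->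
  (size ii).+1 = size H ->
  Dl f (rcons H (size H, -1)) (rcons ii x) w =
  let u := uidx H (size H) in let h := derive1n (size H).-1 f in
  let WB := Wm (B H ii (size H)) w in let WD := Wm (D H ii (size H)) w in
  \int[lebesgue_measure]_(v in `[0, 1])
    ((size H - u).+1%:R * v ^+ (size H - u) *
      (h (v * WD + (1 - v) * WB) - h WD)).
Proof.
move=> gH H1 iH; have tH := genogram_treelike gH.
set G := rcons H _; have sG : size G = (size H).+1 by rewrite size_rcons.
have eG : (size H, - 1) \in ext 0 H by rewrite mem_ext /= !eqxx H1 orbT.
have gG : is_genogram G by apply: ext_genogram eG.
have tG := genogram_treelike gG.
have iG : ident G (size G) = - 1 by rewrite sG ident_rcons_last.
have pG : parent G (size G) = size H by rewrite sG parent_rcons_last.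
have [uH _] := uidx_prop gH (j := size H) ltac:(lia).
have uG : uidx G (size G) = uidx H (size H).
  by rewrite uidx_neg ?iG ?pG ?uidx_rcons //; lia.
have pGs : (0 < parent G (size G) < size G)%N by rewrite pG sG; lia.
have BG : B G (rcons ii x) (size G) = B H ii (size H).
  rewrite (@BsetE_neg _ m prec T _ _ _ gG) ?iG //; last by rewrite sG; lia.
  by rewrite pG (Bset_rcons _ _ _ _ gH eG) ?Bset_local //; lia.
have DG : D G (rcons ii x) (size G) = D H ii (size H).
  rewrite DsetE // iG pG.
  by rewrite fset0U Dset_rcons ?Dset_local //=; lia.
rewrite /Delta uG ifF; last by rewrite sG; lia.
rewrite BG DG sG /=.
have -> : ((size H).+1 - 2 = (size H).-1)%N by lia.
by rewrite subSn //; lia.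
Qed.

Lemma Delta_step H ii f w : is_genogram H -> (1 < size H)%N ->
  (size ii).+1 = size H ->
  (forall x : R, is_derive x 1 (derive1n (size H - 2) f) (derive1n (size H).-1
    f x)) ->
  continuous (derive1n (size H).-1 f) ->
  Dl f H ii w =
  \sum_(x <- B H ii (size H) `\` D H ii (size H))
    (- (isig / ((size H).+1 - uidx H (size H))%N%:R)) *
    (X x w * (derive1n (size H).-1 f (Wm (D H ii (size H)) w) +
       Dl f (rcons H (size H, -1)) (rcons ii x) w)).
Proof.
move=> gH H1 iH dh ch.
have [uH _] := uidx_prop gH (j := size H) ltac:(lia).
set n := (size H - uidx H (size H))%N.
have nE : ((size H).+1 - uidx H (size H) = n.+1)%N by rewrite subSn //; lia.
under eq_bigr => x _ do rewrite Delta_neg //= -/n.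
set r := derive1n _ f _ + _.
under eq_bigr => x _ do rewrite [X x w * r]mulrC mulrA.
rewrite -mulr_sumr.
have DB : D H ii (size H) `<=` B H ii (size H) by apply: Dset_sub_Bset => //; lia.
have BT : B H ii (size H) `<=` T by apply: Bset_sub => //; lia.
have WE := Wminus_sub w DB BT.
have tE := taylor_remainder (Wm (D H ii (size H)) w) (Wm (B H ii (size H)) w) n
  dh ch.
rewrite -/r WE in tE.
have -> : Dl f H ii w = if n == 0%N
    then derive1n (size H - 2) f (Wm (B H ii (size H)) w) -
         derive1n (size H - 2) f (Wm (D H ii (size H)) w)
    else \int[lebesgue_measure]_(v in `[0, 1]) (n%:R * v ^+ n.-1 *
      (derive1n (size H - 2) f (v * Wm (D H ii (size H)) w +
        (1 - v) * Wm (B H ii (size H)) w) -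
       derive1n (size H - 2) f (Wm (D H ii (size H)) w))).
  rewrite /Delta.
  have -> : ((size H).-1 - uidx H (size H) = n.-1)%N by lia.
  by have -> : (uidx H (size H) == size H) = (n == 0%N) by lia.
by rewrite tE nE; ring.
Qed.

End Expansion.

(** * One-step expansion *)

Section NewVertex.
Context {disp : measure_display} {Omega : measurableType disp} {R : realType}.
Variable P : probability Omega R.
Implicit Types (G H : genogram) (e : nat * int) (Y : seq (Omega -> R)) (y z :
  Omega -> R).

Lemma EG_new_nonneg H Y y e z : (size Y).+1 = size H -> e.1 = size H -> 0 <= e.2 ->
  last_blocks (rcons H e) (rcons (rcons Y y) z) =
    rcons (rcons (init_blocks H Y) (fun w => last_block H Y w * y w)) z /\
  EG P (rcons H e) (rcons (rcons Y y) z) = head_factor P H Y *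
    Dstar P (rcons (rcons (init_blocks H Y) (fun w => last_block H Y w * y w)) z).
Proof.
move=> YH e1 e2; have H0 : (0 < size H)%N by rewrite -YH.
have lE : last_blocks (rcons H e) (rcons (rcons Y y) z) =
    rcons (rcons (init_blocks H Y) (fun w => last_block H Y w * y w)) z.
  by rewrite last_blocks_nonneg ?size_rcons // last_blocks_split.
split=> //; rewrite EGE ?size_rcons // lE head_factor_new //.
by rewrite !head_factor_rcons ?size_rcons ?YH //; rewrite -YH; lia.
Qed.

Lemma EG_new_neg H Y y e z : (size Y).+1 = size H -> e.1 = size H -> e.2 < 0 ->
  last_blocks (rcons H e) (rcons (rcons Y y) z) =
    rcons (init_blocks H Y) (fun w => last_block H Y w * (y w * z w)) /\
  EG P (rcons H e) (rcons (rcons Y y) z) = head_factor P H Y *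
    Dstar P (rcons (init_blocks H Y) (fun w => last_block H Y w * (y w * z w))).
Proof.
move=> YH e1 e2; have H0 : (0 < size H)%N by rewrite -YH.
have lE := last_blocks_neg y z YH e1 e2.
split=> //; rewrite EGE ?size_rcons // lE head_factor_new //.
by rewrite !head_factor_rcons ?size_rcons ?YH //; rewrite -YH; lia.
Qed.

Lemma EG_split H Y y : (size Y).+1 = size H ->
  EG P H (rcons Y y) = head_factor P H Y *
    Dstar P (rcons (init_blocks H Y) (fun w => last_block H Y w * y w)).
Proof.
move=> YH; have H0 : (0 < size H)%N by rewrite -YH.
by rewrite EGE // last_blocks_split // head_factor_rcons ?YH.
Qed.

End NewVertex.

Section OneStep.
Context {disp : measure_display} {Omega : measurableType disp} {R : realType}.
Variables (P : probability Omega R) (d m : nat) (prec : rel 'rV[int]_d).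
Variables (T : {fset 'rV[int]_d}) (X : 'rV[int]_d -> {RV P >-> R}) (N : nat).
Hypothesis prec_irr : irreflexive prec.
Hypothesis X_moment : forall i, i \in T ->
  ('E_P[fun w => (`|X i w| ^+ N)%R] < +oo)%E.
Implicit Types (G H : genogram) (e : nat * int) (ii jj : seq 'rV[int]_d)
  (f : R -> R) (J : {fset 'rV[int]_d}).

Local Notation S := (#|` T|).
Local Notation B := (Bset m prec T).
Local Notation D := (Dset m prec T).
Local Notation Wm := (Wminus T X).
Local Notation isig := (sigma T X)^-1.
Local Notation Ua := (Uargs m prec T X).
Local Notation Xs := (map (fun i => X i : Omega -> R)).

Definition finite_ext f H jj := forall e, e \in ext S H ->
  finite_Dstar P (last_blocks (rcons H e) (Ua f (rcons H e) jj)).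

(** Integration by parts, which requires order at least 2, is kept out of this lemma, so the root
    step can use it too. It is [Dstar_merge] with [Z0] in the role of z. *)
Lemma path_step f H ii x : is_genogram H -> (size H <= N)%N ->
  (size ii).+1 = size H -> {in rcons ii x, forall i, i \in T} ->
  finite_ext f H (rcons ii x) ->
  let h := derive1n (size H).-1 f in
  let Z w := X x w * h (Wm (D H ii (size H)) w) in
  finite_Dstar P (rcons (init_blocks H (Xs ii))
    (fun w => last_block H (Xs ii) w * Z w)) /\
  EG P H (rcons (Xs ii) Z) =
    EG P H (Xs (rcons ii x)) * Ex P (fun w => h (W T X w))
    + \sum_(e <- side_ext H (size H)) EG P (rcons H e) (Ua f (rcons H e) (rcons
      ii x))
    - \sum_(s <- iota 0 S.+1)
        EG P (rcons H (size H, s%:Z)) (Ua f (rcons H (size H, s%:Z)) (rcons ii x)).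
Proof.
move=> gH HN iH jT fin h Z; have H0 := genogram_nonempty gH.
have tH := genogram_treelike gH.
set A := init_blocks H _; set b := last_block H _.
have sXi : (size (Xs ii)).+1 = size H by rewrite size_map.
have sXj : size (Xs (rcons ii x)) = size H by rewrite size_map size_rcons.
set jj := rcons ii x in jT fin sXj *.
have XsE : Xs jj = rcons (Xs ii) (X x) by rewrite map_rcons.
pose y : Omega -> R := fun w => b w * X x w.
pose Dl s := Delta m prec T X f (rcons H (size H, Posz s)) jj.
pose Ds e := Delta m prec T X f (rcons H e) jj.
pose Z0 w := h (Wm (D H ii (size H)) w).
have DE : D H jj (size H) = D H ii (size H) by apply: Dset_local => //; lia.
have fy : finite_Dstar P (rcons A y).
  have := finite_Dstar_blocks (T := mem T) X_moment H0 (jj := jj).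
  rewrite XsE last_blocks_split //; apply => //; first by rewrite size_rcons.
  exact/allP.
have fl s : s \in iota 0 S.+1 -> finite_Dstar P (rcons (rcons A y) (Dl s)).
  move=> sS; have sE : (size H, Posz s) \in ext S H.
    rewrite mem_ext eqxx; move: sS; rewrite mem_iota /= => sS.
    by apply/orP; left; lia.
  have := fin _ sE; rewrite /Uargs XsE.
  by rewrite (EG_new_nonneg P _ _ sXi _ _).1.
have [fsum Dsum] := finite_Dstar_sum fl.
have Z0E : Z0 = fun w => h 0 + (-1) * \sum_(s <- iota 0 S.+1) Dl s w.
  by apply/funext => w; rewrite Delta_path_sum // DE /Z0 -/h; ring.
have fZ0 : finite_Dstar P (rcons (rcons A y) Z0).
  by rewrite Z0E; apply: finite_Dstar_lin => //; exact: finite_Dstar_cst.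
have DZ0 : Dstar P (rcons (rcons A y) Z0) =
    - \sum_(s <- iota 0 S.+1) Dstar P (rcons (rcons A y) (Dl s)).
  rewrite Z0E Dstar_lin //; last exact: finite_Dstar_cst.
  (* The argument [y] precedes [Z0], so the constant h(0) meets the centering and disappears. *)
  by rewrite Dstar_cst ?Dsum ?mulN1r ?add0r //; case: (A).
have [fyZ DyZ] := Dstar_merge fy fZ0.
have sideN e : e \in side_ext H (size H) -> e.1 != size H.
  move=> /mem_side_ext[c [/(mem_lineage tH H0) cH _ -> _]].
  by have := tH c ltac:(lia); lia.
have fs e : e \in side_ext H (size H) -> finite_Ex P (Ds e).
  move=> eH; have := fin e; rewrite mem_ext eH !orbT => /(_ isT).
  by rewrite /Uargs last_blocks_side // sideN.
have [ExZ0 fW] : Ex P Z0 = Ex P (fun w => h (W T X w))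
    + \sum_(e <- side_ext H (size H)) Ex P (Ds e) /\ True.
  have fZ0' := finite_Dstar_last fZ0.
  have WE : (fun w => h (W T X w)) =
      fun w => Z0 w + (-1) * \sum_(e <- side_ext H (size H)) Ds e w.
    by apply/funext => w; rewrite Delta_side_sum // DE /Z0 -/h; ring.
  by rewrite WE Ex_lin ?Ex_sum //; [split=> //; ring | exact: finite_Ex_sum].
have bZE : (fun w => b w * Z w) = fun w => y w * Z0 w.
  by apply/funext => w; rewrite /y /Z mulrA.
rewrite -/A -/b bZE; split=> //.
have -> : \sum_(e <- side_ext H (size H)) EG P (rcons H e) (Ua f (rcons H e) jj) =
    EG P H (Xs jj) * \sum_(e <- side_ext H (size H)) Ex P (Ds e).
  rewrite mulr_sumr; apply: eq_big_seq => e eH.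
  by rewrite /Uargs EG_side ?sideN.
have -> : \sum_(s <- iota 0 S.+1)
      EG P (rcons H (size H, s%:Z)) (Ua f (rcons H (size H, s%:Z)) jj) =
    head_factor P H (Xs ii) *
      \sum_(s <- iota 0 S.+1) Dstar P (rcons (rcons A y) (Dl s)).
  rewrite mulr_sumr; apply: eq_big_seq => s sS; rewrite /Uargs XsE.
  by rewrite (EG_new_nonneg P _ _ sXi _ _).2.
rewrite EG_split // -/A -/b bZE DyZ DZ0 XsE EG_split // -/A -/b -/y ExZ0.
ring.
Qed.

Lemma finite_ext_indices f H jj : is_genogram H ->
  (forall e, e \in ext S H -> finite_Usum m prec T X f (rcons H e)) ->
  jj \in indices m prec T H (size H) -> finite_ext f H jj.
Proof.
move=> gH fin jjI e eH; apply: fin => //.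
by rewrite size_rcons (indices_rcons _ _ _ gH eH).
Qed.

Lemma big_ext (V : nmodType) H (F : nat * int -> V) : (1 < size H)%N ->
  \sum_(e <- ext S H) F e = \sum_(s <- iota 0 S.+1) F (size H, s%:Z) +
    F (size H, - 1) + \sum_(e <- side_ext H (size H)) F e.
Proof.
by move=> H1; rewrite /ext H1 !big_cat big_map big_seq1 /= addrA.
Qed.

Lemma Usum_ext f H e : is_genogram H -> e \in ext S H ->
  Usum m prec T X f (rcons H e) = sigma T X ^- size H *
    \sum_(jj <- indices m prec T H (size H)) EG P (rcons H e) (Ua f (rcons H e) jj).
Proof.
by move=> gH eH; rewrite /Usum size_rcons /= (indices_rcons _ _ _ gH eH).
Qed.

Lemma EG_Delta_step f H ii : is_genogram H -> (1 < size H <= N)%N ->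
  (forall x : R, is_derive x 1 (derive1n (size H - 2) f) (derive1n (size H).-1
    f x)) ->
  continuous (derive1n (size H).-1 f) ->
  (forall e, e \in ext S H -> finite_Usum m prec T X f (rcons H e)) ->
  ii \in indices m prec T H (size H).-1 ->
  finite_Dstar P (last_blocks H (Ua f H ii)) /\
  EG P H (Ua f H ii) = - (isig / ((size H).+1 - uidx H (size H))%N%:R) *
   \sum_(x <- B H ii (size H) `\` D H ii (size H)) (
     EG P H (Xs (rcons ii x)) * Ex P (fun w => derive1n (size H).-1 f (W T X w))
     + \sum_(e <- side_ext H (size H)) EG P (rcons H e) (Ua f (rcons H e)
       (rcons ii x))
     - \sum_(s <- iota 0 S.+1)
         EG P (rcons H (size H, s%:Z)) (Ua f (rcons H (size H, s%:Z)) (rcons ii x))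
     + EG P (rcons H (size H, - 1)) (Ua f (rcons H (size H, - 1)) (rcons ii x))).
Proof.
move=> gH /andP[H1 HN] dh ch fin iiI; set q := - (_ / _).
have iH : (size ii).+1 = size H by rewrite (size_indices iiI); lia.
have sXi : (size (Xs ii)).+1 = size H by rewrite size_map.
set r := B H ii (size H) `\` D H ii (size H).
have rI x : x \in r -> rcons ii x \in indices m prec T H (size H).
  move=> xr; rewrite -[size H]prednK; last lia.
  by apply/indicesP; exists ii, x; rewrite prednK //; lia.
have jT x : x \in r -> {in rcons ii x, forall i, i \in T}.
  by move=> /rI; apply: indices_mem.
pose h := derive1n (size H).-1 f.
pose Z x w := X x w * h (Wm (D H ii (size H)) w).
pose Dm x := Delta m prec T X f (rcons H (size H, - 1)) (rcons ii x).
have finx x (xr : x \in r) : finite_ext f H (rcons ii x).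
  by apply: finite_ext_indices => //; exact: rI.
have negE : (size H, - 1) \in ext S H by rewrite mem_ext !eqxx H1 orbT.
have XsE x : Xs (rcons ii x) = rcons (Xs ii) (X x) by rewrite map_rcons.
have lneg x := @EG_new_neg _ _ _ P H (Xs ii) (X x) (size H, - 1) (Dm x) sXi
  erefl isT.
set A := init_blocks H (Xs ii) in lneg; set b := last_block H (Xs ii) in lneg.
pose F x w := q * (b w * Z x w + 1 * (b w * (X x w * Dm x w))).
have fbZ x : x \in r -> finite_Dstar P (rcons A (fun w => b w * Z x w)).
  by move=> xr; have [] := path_step gH HN iH (jT x xr) (finx x xr).
have fbD x : x \in r ->
    finite_Dstar P (rcons A (fun w => b w * (X x w * Dm x w))).
  move=> xr; rewrite -(lneg x).1; have := finx x xr _ negE.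
  by rewrite /Uargs XsE.
have fF x : x \in r -> finite_Dstar P (rcons A (F x)).
  move=> xr; apply: (finite_DstarZ q _).1.
  by apply: finite_Dstar_lin; [exact: fbZ | exact: fbD].
have DF x : x \in r -> Dstar P (rcons A (F x)) =
    q * (Dstar P (rcons A (fun w => b w * Z x w)) +
      Dstar P (rcons A (fun w => b w * (X x w * Dm x w)))).
  move=> xr; rewrite (finite_DstarZ q _).2.
    by rewrite Dstar_lin ?mul1r; [|exact: fbZ|exact: fbD].
  by apply: finite_Dstar_lin; [exact: fbZ | exact: fbD].
have [fS DS] := finite_Dstar_sum fF.
have bD : (fun w => b w * Delta m prec T X f H ii w) = fun w => \sum_(x <- r) F x w.
  apply/funext => w; rewrite Delta_step // mulr_sumr; apply: eq_bigr => x _.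
  by rewrite -/q /F /Z /Dm /h; ring.
split; first by rewrite /Uargs last_blocks_split // -/A -/b bD.
rewrite [in LHS]/Uargs EG_split // -/A -/b bD DS !mulr_sumr; apply: eq_big_seq
  => x xr.
rewrite DF //.
have -> : EG P (rcons H (size H, -1)) (Ua f (rcons H (size H, -1)) (rcons ii x)) =
    head_factor P H (Xs ii) * Dstar P (rcons A (fun w => b w * (X x w * Dm x w))).
  by rewrite /Uargs XsE (lneg x).2.
have := (path_step gH HN iH (jT x xr) (finx x xr)).2.
rewrite EG_split // -/A -/b -/h -/(Z x) => PE.
by rewrite mulrCA mulrDr PE.
Qed.

(** In [EG_Delta_step] side vertices and identifier -1 carry a plus sign and the other children a
    minus sign. The leading minus turns these into the signs given by [ext_sign], and the
    denominator becomes the new factor of [bcoef]. *)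
Lemma Usum_step f H : is_genogram H -> (1 < size H <= N)%N ->
  (forall x : R, is_derive x 1 (derive1n (size H - 2) f) (derive1n (size H).-1
    f x)) ->
  continuous (derive1n (size H).-1 f) ->
  (forall e, e \in ext S H -> finite_Usum m prec T X f (rcons H e)) ->
  finite_Usum m prec T X f H /\
  bcoef R H * Usum m prec T X f H =
   - (bcoef R H / ((size H).+1 - uidx H (size H))%N%:R * Ssum m prec T X H) *
     Ex P (fun w => derive1n (size H).-1 f (W T X w)) +
   \sum_(e <- ext S H) bcoef R (rcons H e) * Usum m prec T X f (rcons H e).
Proof.
move=> gH HN dh ch fin.
have step ii := EG_Delta_step gH HN dh ch fin (ii := ii).
split; first by move=> ii /step[].
have H1 : (1 < size H)%N by lia.
rewrite [in LHS]/Usum (eq_big_seq _ (fun ii iiI => (step ii iiI).2)) -mulr_sumr.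
set c := ((size H).+1 - _)%N%:R; set E := Ex P _.
pose V e := \sum_(jj <- indices m prec T H (size H)) EG P (rcons H e) (Ua f
  (rcons H e) jj).
have -> : \sum_(e <- ext S H) bcoef R (rcons H e) * Usum m prec T X f (rcons H e) =
    bcoef R H / c * sigma T X ^- size H * (\sum_(s <- iota 0 S.+1) V (size H, s%:Z)
      - V (size H, - 1) - \sum_(e <- side_ext H (size H)) V e).
  rewrite big_ext // !mulrBr; congr (_ + _ + _).
  - rewrite mulr_sumr; apply: eq_big_seq => s; rewrite mem_iota /= => sS.
    have eH : (size H, s%:Z) \in ext S H.
      by rewrite mem_ext eqxx /=; apply/orP; left; lia.
    rewrite (bcoef_ext _ gH H1 eH) Usum_ext // /ext_sign eqxx /= expr0 mul1r.
    by rewrite mulrA.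
  - have eH : (size H, - 1) \in ext S H by rewrite mem_ext !eqxx H1 orbT.
    rewrite (bcoef_ext _ gH H1 eH) Usum_ext // /ext_sign !eqxx /= expr1 mulN1r.
    rewrite /V; ring.
  rewrite mulr_sumr -sumrN; apply: eq_big_seq => e eS.
  have eH : e \in ext S H by rewrite mem_ext eS !orbT.
  have -> : bcoef R (rcons H e) = - (bcoef R H / c).
    rewrite (bcoef_ext _ gH H1 eH) /ext_sign.
    have tH := genogram_treelike gH.
    move: eS => /mem_side_ext[x [/(mem_lineage tH (ltnW H1)) xH _ -> _]].
    by have := tH x ltac:(lia) => ?; rewrite [_ != _](_ : _ = true) ?expr1
      ?mulN1r //; lia.
  by rewrite Usum_ext // mulNr mulrA.
pose Phi jj := EG P H (Xs jj) * E
  + \sum_(e <- side_ext H (size H)) EG P (rcons H e) (Ua f (rcons H e) jj)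
  - \sum_(s <- iota 0 S.+1)
      EG P (rcons H (size H, s%:Z)) (Ua f (rcons H (size H, s%:Z)) jj)
  + EG P (rcons H (size H, - 1)) (Ua f (rcons H (size H, - 1)) jj).
have -> : \sum_(ii <- indices m prec T H (size H).-1)
    \sum_(x <- B H ii (size H) `\` D H ii (size H)) Phi (rcons ii x) =
    \sum_(jj <- indices m prec T H (size H)) Phi jj.
  by rewrite -[in RHS](prednK (ltnW H1)) big_indicesS prednK // ltnW.
have -> : \sum_(jj <- indices m prec T H (size H)) Phi jj =
    (\sum_(jj <- indices m prec T H (size H)) EG P H (Xs jj)) * E +
    \sum_(e <- side_ext H (size H)) V e -
    \sum_(s <- iota 0 S.+1) V (size H, s%:Z) + V (size H, - 1).
  rewrite /Phi !big_split /= sumrN -mulr_suml; congr (_ + _ - _ + _);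
  by rewrite exchange_big.
have sE : sigma T X ^- size H = sigma T X ^- (size H).-1 * isig.
  by rewrite -invfM -exprSr prednK // ltnW.
by rewrite /Ssum sE; ring.
Qed.

End OneStep.

(** * Expansion and identification of the coefficients *)

Arguments gens : simpl never.

Section Smooth.
Variable R : realType.
Implicit Type f : R -> R.

Lemma Ck_is_derive n f j : Ck n f -> (j < n)%N ->
  forall x : R, is_derive x 1 (derive1n j f) (derive1n j.+1 f x).
Proof.
move=> [df _] jn x; rewrite derive1nS derive1E; apply: derivableP; exact: df.
Qed.

Lemma Ck_continuous n f j : Ck n f -> (j <= n)%N -> continuous (derive1n j f).
Proof.
move=> [df cf]; rewrite leq_eqVlt => /predU1P[->//|jn] x.
by apply: differentiable_continuous; apply/derivable1_diffP; exact: df.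
Qed.

Lemma is_derive_monomial (c : R) n (x : R) :
  is_derive x 1 (fun y : R => c * y ^+ n) (c * n%:R * x ^+ n.-1).
Proof.
have -> : (fun y : R => c * y ^+ n) = cst c * (id : R -> R) ^+ n.
  by apply/funext => y; rewrite !fctE.
by apply: is_derive_eq; rewrite /GRing.scale /=; ring.
Qed.

Lemma derive1n_monomial n i :
  derive1n i (fun x : R => x ^+ n) = fun x => (n ^_ i)%:R * x ^+ (n - i).
Proof.
elim: i => [|i IH]; first by apply/funext => x; rewrite ffactn0 mul1r subn0.
rewrite derive1nS IH; apply/funext => x; rewrite derive1E.
have dm := is_derive_monomial (n ^_ i)%:R (n - i) x.
by rewrite (@derive_val _ _ _ _ _ _ _ dm) ffactnSr natrM subnS.
Qed.

Lemma Ck_monomial n : Ck n (fun x : R => x ^+ n).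
Proof.
have dm i (x : R) : derivable (derive1n i (fun x : R => x ^+ n)) x 1.
  by rewrite derive1n_monomial; have [] := is_derive_monomial (n ^_ i)%:R (n - i) x.
split=> [j x _|x]; first exact: dm.
by apply: differentiable_continuous; apply/derivable1_diffP.
Qed.

End Smooth.

Section Expansion.
Context {disp : measure_display} {Omega : measurableType disp} {R : realType}.
Variables (P : probability Omega R) (d m : nat) (prec : rel 'rV[int]_d).
Variables (T : {fset 'rV[int]_d}) (X : 'rV[int]_d -> {RV P >-> R}) (N : nat).
Hypothesis prec_irr : irreflexive prec.
Hypothesis X_moment : forall i, i \in T ->
  ('E_P[fun w => (`|X i w| ^+ N)%R] < +oo)%E.
Hypothesis X_mean0 : forall i, i \in T -> ('E_P[X i] = 0)%E.
Implicit Types (G H : genogram) (e : nat * int) (ii jj : seq 'rV[int]_d)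
  (f : R -> R) (n : nat).

Local Notation S := (#|` T|).
Local Notation U := (Usum m prec T X).
Local Notation finU := (finite_Usum m prec T X).
Local Notation WX := (W T X).
Local Notation isig := (sigma T X)^-1.
Local Notation b := (bcoef R).

(* Integrability is only assumed at the top order; it descends because
   [Delta_f(H)] is a combination of increments over the extensions of [H]. *)
Lemma finite_gens n0 f : Ck n0 f -> (n0 < N)%N ->
  (forall G, G \in gens S n0.+1 -> finU f G) ->
  forall n, (0 < n <= n0.+1)%N -> forall G, G \in gens S n -> finU f G.
Proof.
move=> fC n0N fin n nn0.
(* Descent from the top order, written as induction on the distance to it. *)
have -> : n = (n0.+1 - (n0.+1 - n))%N by lia.
have : (n0.+1 - n <= n0)%N by lia.
move: (n0.+1 - n)%N => i {n nn0}; elim: i => [|i IH] iN G; first by rewrite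
  subn0; exact: fin.
set n := (n0.+1 - i.+1)%N; have nE : (n0.+1 - i = n.+1)%N by rewrite /n; lia.
move=> GS; have [gG sG] := gens_genogram GS.
have h1 : (size G - 2 < n0)%N by rewrite sG /n; lia.
have h2 : ((size G).-1 = (size G - 2).+1)%N by rewrite sG /n; lia.
apply: (Usum_step prec_irr X_moment gG _ _ _ _).1.
- by rewrite sG /n; lia.
- by rewrite h2; exact: Ck_is_derive h1.
- by rewrite h2; exact: Ck_continuous fC h1.
move=> e eG; apply: IH; first lia.
by rewrite nE; apply/mem_gensS; exists G, e.
Qed.

(** Up to sign, what expanding [H] releases in front of E h(W). For order k + 1 it is also the
    summand of the correction in [kappa_tilde], divided by k!. *)
Definition drop_coef H : R :=
  b H / ((size H).+1 - uidx H (size H))%N%:R * Ssum m prec T X H.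

Lemma gens_step n0 f n (A : pred genogram) : Ck n0 f -> (n0 < N)%N ->
  (0 < n <= n0)%N -> (forall G, G \in gens S n.+1 -> finU f G) ->
  \sum_(H <- gens S n | A H) b H * U f H =
  - (\sum_(H <- gens S n | A H) drop_coef H) * Ex P (fun w => derive1n n f (WX w)) +
  \sum_(G <- gens S n.+1 | A (take n.+1 G)) b G * U f G.
Proof.
move=> fC n0N nn0 fin; rewrite big_gensS mulNr mulr_suml -sumrN -big_split /=.
rewrite [LHS]big_mkcond [RHS]big_mkcond; apply: eq_big_seq => H HS.
case: ifP => // _; have [gH sH] := gens_genogram HS.
have h1 : (size H - 2 < n0)%N by rewrite sH; lia.
have h2 : ((size H).-1 = (size H - 2).+1)%N by rewrite sH; lia.
rewrite (Usum_step prec_irr X_moment gH _ _ _ _).2.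
- by rewrite /drop_coef sH /= mulNr.
- by rewrite sH; lia.
- by rewrite h2; exact: Ck_is_derive h1.
- by rewrite h2; exact: Ck_continuous fC h1.
by move=> e eH; apply: fin; apply/mem_gensS; exists H, e.
Qed.

Lemma side_ext_unit : side_ext [:: (0%N, 0)] 1 = [::].
Proof.
by rewrite /side_ext /lineage ancestors_nil.
Qed.

Lemma EG_unit y : EG P [:: (0%N, 0)] [:: y] = Ex P y.
Proof.
rewrite /EG /= -[qzero _]/(head 0%N (qseq [:: (0%N, 0)])) qseq_unit /=.
by rewrite last_blocks_unit.
Qed.

(** [path_step] at the root, where D is empty and h(W(D_1)) is f(W). The product term vanishes
    because the X_x are centered, and the root has neither side extensions nor a child with
    identifier -1. *)
Lemma gens_base f : (0 < N)%N -> (forall G, G \in gens S 1 -> finU f G) ->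
  Ex P (fun w => WX w * f (WX w)) = \sum_(G <- gens S 1) b G * U f G.
Proof.
move=> N0 fin; set H := [:: (0%N, 0 : int)].
have gH : is_genogram H := genogram_unit.
have finx x : x \in T -> finite_ext m prec T X f H [:: x].
  move=> xT e eH; apply: fin; first by apply/mem_gensS; exists H, e; rewrite
    mem_seq1.
  rewrite size_rcons (indices_rcons _ _ _ gH eH) //; apply/(indicesP _ _ _ _ 0).
  by exists [::], x; rewrite mem_seq1 /= fsetD0.
have xTall x : x \in T -> {in rcons [::] x, forall i, i \in T}.
  by move=> xT i; rewrite mem_seq1 => /eqP ->.
pose Z x w := X x w * f (WX w).
have ZE x : (fun w => X x w * derive1n (size H).-1 f (Wminus T X (Dset m prec T
  H [::] (size H)) w)) = Z x.
  by apply/funext => w; rewrite /= Dset1 Wminus_fset0.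
have fZ x : x \in T -> finite_Ex P (Z x).
  move=> xT; have [+ _] := path_step prec_irr X_moment gH N0 (erefl : (size
    [::]).+1 = size H) (xTall x xT) (finx x xT).
  rewrite -last_blocks_split //= ZE last_blocks_unit; exact.
have EZ x : x \in T -> Ex P (Z x) = - \sum_(s <- iota 0 S.+1)
    EG P (rcons H (1%N, s%:Z)) (Uargs m prec T X f (rcons H (1%N, s%:Z)) [:: x]).
  move=> xT; have [_] := path_step prec_irr X_moment gH N0 (erefl : (size
    [::]).+1 = size H) (xTall x xT) (finx x xT).
  rewrite ZE side_ext_unit big_nil addr0 /= !EG_unit => ->.
  by rewrite /Ex X_mean0 // mul0r sub0r.
have -> : (fun w => WX w * f (WX w)) = fun w => \sum_(x <- T) isig * Z x w.
  apply/funext => w; rewrite {1}/W /sumX mulr_sumr mulr_suml.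
  by apply: eq_bigr => x _; rewrite /Z mulrA.
rewrite Ex_sum; last by move=> x xT; apply: finite_ExZ; exact: fZ.
have := @big_gensS R S 0 (fun G => b G * U f G) predT; rewrite /= => ->.
have extE : ext S H = [seq (size H, s%:Z) | s <- iota 0 S.+1].
  by rewrite /ext (side_ext_unit : side_ext H (size H) = [::]) cats0.
rewrite big_seq1 -/H extE big_map.
have -> : \sum_(s <- iota 0 S.+1) b (rcons H (size H, s%:Z)) * U f (rcons H
  (size H, s%:Z)) =
   \sum_(s <- iota 0 S.+1) - isig * \sum_(x <- T)
     EG P (rcons H (1%N, s%:Z)) (Uargs m prec T X f (rcons H (1%N, s%:Z)) [:: x]).
  apply: eq_big_seq => s; rewrite mem_iota /= => sS.
  have eH : (size H, s%:Z) \in ext S H by rewrite mem_ext eqxx /=; apply/orP;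
    left; lia.
  rewrite (bcoef_ext_unit _ eH) mulN1r mulNr; congr (- _).
  have -> := @Usum_ext _ _ _ P d m prec T X f H _ gH eH.
  by rewrite expr1 (big_indicesS m prec T H 0) big_seq1 fsetD0.
rewrite -mulr_sumr exchange_big mulr_sumr; apply: eq_big_seq => x xT.
by rewrite (ExZ _ (fZ x xT)) (EZ x xT) mulrN mulNr.
Qed.

(** It does not involve f, so it can be computed from a convenient test function. *)
Definition expansion_coef n : R := - \sum_(H <- gens S n) drop_coef H.

Lemma expansion n0 f : Ck n0 f -> (n0 < N)%N ->
  (forall G, G \in gens S n0.+1 -> finU f G) ->
  Ex P (fun w => WX w * f (WX w)) =
  \sum_(1 <= j < n0.+1) expansion_coef j * Ex P (fun w => derive1n j f (WX w))
  + \sum_(G <- gens S n0.+1) b G * U f G.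
Proof.
move=> fC n0N fin.
have fing := finite_gens fC n0N fin.
have claim i : (i <= n0)%N -> Ex P (fun w => WX w * f (WX w)) =
  \sum_(1 <= j < i.+1) expansion_coef j * Ex P (fun w => derive1n j f (WX w))
  + \sum_(G <- gens S i.+1) b G * U f G.
  elim: i => [|i IH] iN.
    by rewrite big_geq // add0r; apply: gens_base; [lia | apply: fing; lia].
  rewrite IH; last lia.
  rewrite (@gens_step n0 _ _ predT fC n0N) //; last by apply: fing; lia.
  by rewrite [in RHS]big_nat_recr //= addrA.
exact: claim.
Qed.

(** Order n + 2 brings increments of the n-th derivative, which is constant for x^n. *)
Lemma Delta_monomial n G ii w : size G = n.+2 ->
  Delta m prec T X (fun x : R => x ^+ n) G ii w = 0.
Proof.
move=> sG; rewrite /Delta sG !subSS subn0 derive1n_monomial subnn.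
case: ifP => _; first by rewrite !expr0 subrr.
under eq_Rintegral do rewrite !expr0 subrr mulr0.
by rewrite Rintegral_cst // mul0r.
Qed.

Lemma Usum0 f G : (0 < size G)%N ->
  (forall ii, ii \in indices m prec T G (size G).-1 ->
    Delta m prec T X f G ii = fun=> 0) ->
  finU f G /\ U f G = 0.
Proof.
move=> G0 D0.
have lE ii : ii \in indices m prec T G (size G).-1 ->
    exists A, last_blocks G (Uargs m prec T X f G ii) = rcons A (fun=> 0).
  move=> iiI; rewrite /Uargs D0 // last_blocks_split.
    eexists; congr rcons; apply/funext => w; exact: mulr0.
  by rewrite size_map (size_indices iiI) prednK.
split; first by move=> ii /lE[A ->]; exact: finite_Dstar_cst.
rewrite /Usum big1_seq ?mulr0 // => ii /andP[_ /lE[A AE]].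
by rewrite EGE // AE Dstar0 mulr0.
Qed.

Lemma finite_Ex_powW n : (n <= N)%N -> finite_Ex P (fun w => WX w ^+ n).
Proof.
move=> nN; have -> : (fun w => WX w ^+ n) =
    fun w => isig ^+ n * (prodX X [::] w * sumX T X w ^+ n).
  by apply/funext => w; rewrite /prodX big_nil mul1r /W exprMn.
apply: finite_ExZ.
(* The power is expanded one factor at a time; [l] collects the summands already chosen, and the
   total degree stays at most N. *)
suff claim l : all (mem T) l -> (size l + n <= N)%N ->
    finite_Ex P (fun w => prodX X l w * sumX T X w ^+ n) by exact: claim.
elim: n l {nN} => [|n IH] l lT lN.
  rewrite (_ : (fun _ => _) = prodX X l); last first.
    by apply/funext => w; rewrite expr0 mulr1.
  by apply: (finite_Ex_prodX (T := mem T) X_moment) => //; lia.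
rewrite (_ : (fun _ => _) = fun w => \sum_(x <- T) prodX X (x :: l) w * sumX T
  X w ^+ n).
  apply: finite_Ex_sum => x xT; apply: IH; first by rewrite /= xT.
  by rewrite /= addSnnS.
apply/funext => w; rewrite exprS {1}/sumX mulrA mulr_sumr mulr_suml.
by apply: eq_bigr => x _; rewrite /prodX big_cons [X x w * _]mulrC.
Qed.

Lemma finite_Ex_X x : (0 < N)%N -> x \in T -> finite_Ex P (X x).
Proof.
move=> N0 xT; rewrite (_ : (X x : Omega -> R) = prodX X [:: x]).
  apply: (finite_Ex_prodX (T := mem T) X_moment) => //.
  by apply/allP => y; rewrite mem_seq1 => /eqP ->.
by apply/funext => w; rewrite /prodX big_seq1.
Qed.

Lemma cumulant1 : (0 < N)%N -> cumulant P 1 WX = 0.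
Proof.
move=> N0; have := moment_cumulant P 0 WX.
rewrite big_ord1 ffactn0 subn0 moment0 mulr1 mulr1 fact0 divr1 => <-.
rewrite /moment (_ : (fun _ => _) = fun w => \sum_(x <- T) isig * X x w).
  rewrite Ex_sum; last by move=> x xT; apply: finite_ExZ; exact: finite_Ex_X.
  rewrite big1_seq // => x /andP[_ xT]; rewrite ExZ; last exact: finite_Ex_X.
  by rewrite /Ex X_mean0 // mulr0.
by apply/funext => w; rewrite expr1 /W /sumX mulr_sumr.
Qed.

Lemma expansion_coef_cumulant n : (0 < n < N)%N ->
  expansion_coef n = cumulant P n.+1 WX / n`!%:R.
Proof.
elim/ltn_ind: n => n IH /andP[n0 nN].
have zero G : G \in gens S n.+1 -> finU (fun x : R => x ^+ n) G /\ U (fun x : R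
  => x ^+ n) G = 0.
  move=> /gens_genogram[_ sG]; apply: Usum0; first by rewrite sG.
  by move=> ii _; apply/funext => w; exact: Delta_monomial.
have := expansion (@Ck_monomial R n) nN (fun G GS => (zero G GS).1).
rewrite [X in _ + X]big1_seq ?addr0; last first.
  by move=> G /andP[_ /zero[_ ->]]; rewrite mulr0.
have -> : (fun w => WX w * WX w ^+ n) = fun w => WX w ^+ n.+1.
  by apply/funext => w; rewrite exprS.
have mE j : (j <= n)%N -> Ex P (fun w => derive1n j (fun x : R => x ^+ n) (WX w)) =
    (n ^_ j)%:R * moment P (n - j) WX.
  move=> jn; rewrite derive1n_monomial ExZ //; apply: finite_Ex_powW; lia.
rewrite -/(moment P n.+1 WX) (moment_cumulant P) -(big_mkord predT (fun i =>
  cumulant P i.+1 WX / i`!%:R * ((n ^_ i)%:R * moment P (n - i) WX))).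
(* The term of index 0 contains the mean of W and vanishes. The term of index n is split off because
   the induction hypothesis covers smaller indices only. *)
rewrite big_ltn // cumulant1 ?(leq_trans _ nN) // !mul0r add0r big_nat_recr //=
  [in RHS]big_nat_recr //=.
rewrite (eq_big_nat _ _ (F2 := fun j => expansion_coef j *
    Ex P (fun w => derive1n j (fun x : R => x ^+ n) (WX w)))); last first.
  by move=> j jn; rewrite IH ?mE //; lia.
(* The two remaining coefficients are multiplied by n!, the n-th derivative of x^n, which can be
   cancelled. *)
rewrite mE // subnn moment0 mulr1 ffactnn => /addrI/mulIf -> //.
Qed.

(** * Vanishing beyond identifier |T| and reduction to finite lists *)

Lemma Usum_saturated f G j : is_genogram G -> (1 < size G)%N ->
  S%:Z < ident G j -> U f G = 0.
Proof.
move=> gG G1 sj; have tG := genogram_treelike gG.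
have jG : (1 < j <= size G)%N.
  rewrite leqNgt [(j <= _)%N]leqNgt -negb_or; apply/negP => /orP[j1|j1].
    move: sj; have [->|->] : j = 0%N \/ j = 1%N by lia.
      by rewrite /ident.
    by case: (genogram_root gG) => _ ->.
  by move: sj; rewrite /ident /entry nth_default.
(* Below the last label the range of i_j is empty. The last vertex is not summed over in U_f; there
   B = D makes the increment vanish. *)
have [jN|jN] := ltnP j (size G).
  rewrite /Usum (indices_saturated _ (j := j) prec_irr gG) ?big_nil ?mulr0 //; lia.
have jE : j = size G by lia.
have pj := genogram_tree gG (j := j) jG.
apply: (Usum0 _ _).2; first lia.
move=> ii _; apply/funext => w; rewrite /Delta uidx_nonneg // -?jE ?eqxx; last lia.
have DT := Dset_sub m prec T ii gG (j := parent G j) ltac:(lia).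
have [-> ->] := Dset_saturated prec_irr tG pj DT sj.
exact: subrr.
Qed.

Lemma Ssum_saturated G j : is_genogram G ->
  S%:Z < ident G j -> Ssum m prec T X G = 0.
Proof.
move=> gG sj.
have jG : (1 < j <= size G)%N.
  rewrite leqNgt [(j <= _)%N]leqNgt -negb_or; apply/negP => /orP[j1|j1].
    move: sj; have [->|->] : j = 0%N \/ j = 1%N by lia.
      by rewrite /ident.
    by case: (genogram_root gG) => _ ->.
  by move: sj; rewrite /ident /entry nth_default.
by rewrite /Ssum (indices_saturated _ (j := j) prec_irr gG) ?big_nil ?mulr0.
Qed.

Lemma gens_complete n G : genograms n.+1 G -> G \notin gens S n ->
  exists j, S%:Z < ident G j.
Proof.
move=> [gG sG] GS; apply: contrapT => nj; move/negP: GS; apply.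
apply: genogram_gens => // j; rewrite leNgt; apply/negP => sj.
by apply: nj; exists j.
Qed.

(** A genogram missing from the list has an identifier above |T|, where [F] vanishes; so the list
    covers the support of a possibly infinite family. *)
Lemma fsbig_gens n (A : set genogram) (a : pred genogram) (F : genogram -> R) :
  (A `<=` genograms n.+1)%classic -> (forall G, genograms n.+1 G -> A G <-> a G) ->
  (forall G j, genograms n.+1 G -> S%:Z < ident G j -> F G = 0) ->
  \sum_(G \in A) F G = \sum_(G <- gens S n | a G) F G.
Proof.
move=> AG Aa F0; rewrite (fsbigE [seq G <- gens S n | a G]) ?filter_uniq
  ?gens_uniq //.
- rewrite -[RHS]big_filter big_mkcond; apply: eq_big_seq => G.
  rewrite mem_filter => /andP[aG /gens_genogram gG].
  by rewrite mem_set //; apply/Aa.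
- move=> G /=; rewrite mem_filter => /andP[aG /gens_genogram gG].
  by apply/Aa.
move=> G AGG; rewrite mem_filter; have gG := AG _ AGG.
have -> /= : a G by apply/Aa.
by move=> /(gens_complete gG)[j sj]; exact: F0 sj.
Qed.

End Expansion.

(** One condition on the first k + 1 identifiers decides all families of the second expansion: at
    order k + 2 it characterizes the union of P_0 and P_1, and at order k + 1 its failure
    characterizes G_0. Hence the genograms of order k + 2 that violate it are those extending G_0(k
    + 1). *)
Definition nonpos_upto n (G : genogram) : bool :=
  all (fun j => ident G j <= 0) (iota 1 n).

Lemma nonpos_uptoP n G : reflect (forall j, (1 <= j <= n)%N -> ident G j <= 0)
  (nonpos_upto n G).
Proof.
apply: (iffP allP) => h j; last by rewrite mem_iota => jn; apply: h; lia.
by move=> jn; apply: h; rewrite mem_iota; lia.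
Qed.

Lemma nonpos_upto_take n G : size G = n.+1 ->
  nonpos_upto n (take n G) = nonpos_upto n G.
Proof.
case/lastP: G => // G e; rewrite size_rcons => -[sG].
rewrite -[in take _ _]cats1 take_size_cat //; apply: eq_in_all => j.
by rewrite mem_iota => jn; rewrite ident_rcons //; lia.
Qed.

Lemma P0P1_nonpos k G : genograms k.+1 G ->
  (P0 k.+1 G \/ P1 k.+1 G) <-> nonpos_upto k G.
Proof.
move=> gG; split=> [[[_ h]|[_ [h _]]]|/nonpos_uptoP h]; try apply/nonpos_uptoP
  => j jk.
- by apply: h; lia.
- by apply: h.
have [sk|sk] := lerP (ident G k.+1) 0; last by right; split=> //; split=> //; lia.
left; split=> // j jk; have [->//|jk'] := eqVneq j k.+1.
by apply: h; lia.
Qed.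

Lemma G0_nonpos k G : genograms k G -> G0 k G <-> ~~ nonpos_upto k G.
Proof.
move=> gG; split=> [[_ nP]|/negP nP]; last by split=> // -[_ /nonpos_uptoP].
by apply/negP => /nonpos_uptoP h; apply: nP; split.
Qed.

Theorem corollaryE4 (R : realType) (disp : measure_display)
    (Omega : measurableType disp) (P : probability Omega R)
    (d m : nat) (prec : rel 'rV[int]_d) (T : {fset 'rV[int]_d})
    (X : 'rV[int]_d -> {RV P >-> R}) (k : nat) (f : R -> R)
    (m_gt0 : (0 < m)%N)
    (prec_irr : irreflexive prec) (prec_trans : transitive prec)
    (prec_total : forall i j : 'rV[int]_d, i != j -> prec i j || prec j i)
    (T_neq0 : T != fset0)
    (var_gt0 : (0 < 'V_P[sumX T X])%E)
    (k_ge1 : (1 <= k)%N)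
    (X_mean0 : forall i, i \in T -> ('E_P[X i] = 0)%E)
    (X_moment : forall i, i \in T ->
       ('E_P[fun w => (`|X i w| ^+ k.+1)%R] < +oo)%E)
    (f_Ck : Ck k f)
    (fin_Wf : finite_Ex P (fun w => W T X w * f (W T X w)))
    (fin_df : forall j, (1 <= j <= k)%N ->
       finite_Ex P (fun w => derive1n j f (W T X w)))
    (fin_U : forall H, (genograms k.+2 `|` G0 k.+1)%classic H ->
       finite_Usum m prec T X f H) :
  Ex P (fun w => W T X w * f (W T X w)) =
    \sum_(1 <= j < k.+1)
       cumulant P j.+1 (W T X) / j`!%:R * Ex P (fun w => derive1n j f (W T X w))
    + \sum_(H \in genograms k.+2) bcoef R H * Usum m prec T X f H
  /\
  Ex P (fun w => W T X w * f (W T X w)) =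
    \sum_(1 <= j < k)
       cumulant P j.+1 (W T X) / j`!%:R * Ex P (fun w => derive1n j f (W T X w))
    + kappa_tilde m prec T X k / k`!%:R * Ex P (fun w => derive1n k f (W T X w))
    + \sum_(H \in (P0 k.+2 `|` P1 k.+2 `|` G0 k.+1)%classic)
         bcoef R H * Usum m prec T X f H.

Proof.
have N0 : (0 < k.+1)%N by [].
set E := Ex P (fun w => derive1n k f (W T X w)).
pose S := #|` T|; pose b := bcoef R; pose U := Usum m prec T X f.
have fin G : G \in gens S k.+1 -> finite_Usum m prec T X f G.
  by move=> /gens_genogram[gG sG]; apply: fin_U; left.
have kappaE j : (0 < j <= k)%N ->
    expansion_coef m prec T X j = cumulant P j.+1 (W T X) / j`!%:R.
  by move=> jk; apply: (expansion_coef_cumulant m prec_irr X_moment X_mean0); lia.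
have main : Ex P (fun w => W T X w * f (W T X w)) =
    \sum_(1 <= j < k.+1)
       cumulant P j.+1 (W T X) / j`!%:R * Ex P (fun w => derive1n j f (W T X w))
    + \sum_(G <- gens S k.+1) b G * U G.
  rewrite (expansion prec_irr X_moment X_mean0 f_Ck (ltnSn k) fin); congr (_ + _).
  by apply: eq_big_nat => j jk; rewrite kappaE.
have Usat n G j : (0 < n)%N -> genograms n.+1 G -> S%:Z < ident G j -> b G * U G = 0.
  move=> n0 [gG sG] sj; rewrite /U (Usum_saturated m X prec_irr f gG _ sj) ?mulr0 //.
  by rewrite sG.
split.
  rewrite main (fsbig_gens (T := T) (n := k.+1) (a := predT)) //.
  by move=> G j gG sj; apply: Usat gG sj.
pose np := nonpos_upto k.+1.
have U12 : \sum_(H \in (P0 k.+2 `|` P1 k.+2 `|` G0 k.+1)%classic) b H * U H =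
    \sum_(G <- gens S k.+1 | np G) b G * U G +
    \sum_(G <- gens S k | ~~ np G) b G * U G.
  rewrite (fsbigE ([seq G <- gens S k.+1 | np G] ++ [seq G <- gens S k | ~~ np G])).
  - rewrite big_cat -[X in _ = X + _]big_filter -[X in _ = _ + X]big_filter.
    congr (_ + _); rewrite big_mkcond; apply: eq_big_seq => G;
      rewrite mem_filter => /andP[npG /gens_genogram gG]; rewrite mem_set //.
      by left; apply/P0P1_nonpos.
    by right; apply/G0_nonpos.
  - rewrite cat_uniq !filter_uniq ?gens_uniq // andbT; apply/hasPn => G.
    rewrite !mem_filter => /andP[_ /gens_genogram[_ sG]].
    by apply/negP => /andP[_ /gens_genogram[_]]; rewrite sG; lia.
  - move=> G /=; rewrite mem_cat !mem_filter => /orP[|] /andP[npG /gens_genogram gG].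
      by left; apply/P0P1_nonpos.
    by right; apply/G0_nonpos.
  move=> G [PG|GG]; rewrite mem_cat !mem_filter => /norP[nG1 nG2].
    have gG : genograms k.+2 G by case: PG => -[].
    have [|j sj] := gens_complete (T := T) gG; last exact: Usat gG sj.
    by apply: contra nG1 => ->; rewrite andbT; apply/P0P1_nonpos.
  have gG : genograms k.+1 G by case: GG.
  have [|j sj] := gens_complete (T := T) gG; last exact: Usat gG sj.
  by apply: contra nG2 => ->; rewrite andbT; apply/G0_nonpos.
have kE : kappa_tilde m prec T X k / k`!%:R =
    cumulant P k.+1 (W T X) / k`!%:R +
    \sum_(G <- gens S k | ~~ np G) drop_coef m prec T X G.
  rewrite /kappa_tilde (fsbig_gens (T := T) (n := k) (a := fun G => ~~ np G)).
  - rewrite mulrDl; congr (_ + _); rewrite mulr_suml big_seq_cond [RHS]big_seq_cond.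
    apply: eq_bigr => G /andP[/gens_genogram[_ sG] _]; rewrite /drop_coef sG.
    have : k`!%:R != 0 :> R by rewrite pnatr_eq0 -lt0n fact_gt0.
    move: (k`!%:R : R) ((k.+2 - uidx G k.+1)%:R^-1) => c q c0.
    by field.
  - by move=> G [].
  - by move=> G gG; apply: G0_nonpos.
  by move=> G j [gG _] sj; rewrite (Ssum_saturated m X prec_irr gG sj) mulr0.
rewrite U12 kE main big_nat_recr //= -!addrA; congr (_ + _).
(* The terms of order k + 2 outside P_0 and P_1 belong to extensions of G_0(k + 1). Reading
   [gens_step] backwards folds them into U_f over G_0(k + 1), and the released multiple of [E] is
   the correction in [kappa_tilde]. *)
rewrite (bigID np) /= mulrDl -/E -!addrA; congr (_ + _).
have k0 : (0 < k <= k)%N by lia.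
have := gens_step prec_irr X_moment (fun G => ~~ np G) f_Ck (ltnSn k) k0 fin.
have -> : \sum_(G <- gens S k.+1 | ~~ np (take k.+1 G)) b G * U G =
    \sum_(G <- gens S k.+1 | ~~ np G) b G * U G.
  rewrite [LHS]big_mkcond [RHS]big_mkcond; apply: eq_big_seq => G.
  by move=> /gens_genogram[_ sG]; rewrite /np nonpos_upto_take.
rewrite -/E => ->; ring.
Qed.
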